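(* Let $M$ be a simply-connected finite-dimensional topological manifold without boundary, of dimension at least $3$. Then $cat(\Sigma F(M,k))=2$ for every integer $k\geq 2$.
   Context: For a topological space $M$ and an integer $k\ge 1$, the (ordered) configuration space is the subspace $F(M,k)=\{(m_1,\ldots,m_k)\in M^k \mid m_i\neq m_j \text{ for all } i\neq j\}$ of $M^k$. $\Sigma X$ denotes the non-reduced suspension of $X$: the quotient of $X\times[0,1]$ obtained by collapsing $X\times\{0\}$ to one point and $X\times\{1\}$ to another point. The Lusternik-Schnirelmann category $cat(X)$ of a space $X$ is the least integer $m$ such that $X$ can be covered by $m$ open sets, each of which is contractible within $X$ (i.e. its inclusion into $X$ is null-homotopic); $cat(X)=\infty$ if no such $m$ exists. (With this convention $cat(X)=1$ if and only if $X$ is contractible.) *)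

(* Defs.v *)
From HB Require Import structures.
From mathcomp Require Import all_boot all_order all_algebra generic_quotient.
From mathcomp Require Import all_classical all_reals.
From mathcomp Require Import topology normedtype homotopy.

Set Implicit Arguments.
Unset Strict Implicit.
Unset Printing Implicit Defensive.

Import Order.TTheory GRing.Theory Num.Theory.
Import numFieldNormedType.Exports.

Local Open Scope classical_set_scope.
Local Open Scope ring_scope.

(* Subsets are turned into spaces through the coercion [set_type], which the
   library equips with the subspace (initial) topology. *)

Section unit_interval.
Context (R : realType).

Definition unit_interval : Type := set_type `[0 : R, 1]%classic.

HB.instance Definition _ :=
  Topological.copy unit_interval (set_type `[0 : R, 1]%classic).

Fact unit_interval_mem0 : (0 : R) \in `[0 : R, 1]%classic.
Proof. by rewrite mem_setE in_itv/= lexx ler01. Qed.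

Fact unit_interval_mem1 : (1 : R) \in `[0 : R, 1]%classic.
Proof. by rewrite mem_setE in_itv/= lexx ler01. Qed.

Definition unit_interval0 : unit_interval := exist _ 0 unit_interval_mem0.
Definition unit_interval1 : unit_interval := exist _ 1 unit_interval_mem1.

Fact unit_interval_neq : unit_interval0 != unit_interval1.
Proof. by apply/eqP => /(congr1 val)/= /esym/eqP; rewrite oner_eq0. Qed.

HB.instance Definition _ :=
  isBiPointed.Build unit_interval unit_interval_neq.

End unit_interval.

Section homotopies.
Context (R : realType).
Local Notation I := (unit_interval R).

Definition homotopic (S T : topologicalType) (f g : S -> T) : Prop :=
  exists H : S * I -> T, [/\ continuous H,
    forall s, H (s, zero) = f s & forall s, H (s, one) = g s].

Definition null_homotopic (S T : topologicalType) (f : S -> T) : Prop :=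
  exists c : T, homotopic f (cst c).

Definition path_homotopic (T : topologicalType) (x y : T)
    (p q : {path I from x to y}) : Prop :=
  exists H : I * I -> T, [/\ continuous H,
    forall s, H (s, zero) = p s, forall s, H (s, one) = q s,
    forall t, H (zero, t) = x & forall t, H (one, t) = y].

Definition path_connected (T : topologicalType) : Prop :=
  [set: T] !=set0 /\ forall x y : T, exists _ : {path I from x to y}, True.

Definition simply_connected (T : topologicalType) : Prop :=
  path_connected T /\
  forall (x : T) (p : {path I from x to x}), path_homotopic p (cst x).

End homotopies.

Definition homeomorphic (S T : topologicalType) : Prop :=
  exists (f : S -> T) (g : T -> S),
    [/\ continuous f, continuous g, cancel f g & cancel g f].

Definition locally_euclidean (R : realType) (n : nat) (M : topologicalType) :
    Prop :=
  forall x : M, exists (U : set M) (V : set 'rV[R]_n),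
    [/\ open U, U x, open V & homeomorphic (set_type U) (set_type V)].

(* No boundary points are allowed, as charts map onto open sets of R^n and not
   of a half-space. *)
Definition topological_manifold (R : realType) (n : nat) (M : topologicalType) :
    Prop :=
  [/\ hausdorff_space M, @second_countable M & locally_euclidean R n M].

Definition configuration (M : topologicalType) (k : nat) :
    set {ptws 'I_k -> M} :=
  [set m | forall i j : 'I_k, i != j -> m i <> m j].

Definition configuration_space (M : topologicalType) (k : nat) :
    topologicalType := set_type (@configuration M k).

Section suspension.
Context (R : realType) (X : topologicalType).
Local Notation I := (unit_interval R).

Let susp_rel' (a b : X * I) : bool :=
  [|| a == b, (a.2 == zero) && (b.2 == zero) | (a.2 == one) && (b.2 == one)].

Fact susp_rel_refl : reflexive susp_rel'.
Proof. by move=> a; rewrite /susp_rel' eqxx. Qed.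

Fact susp_rel_sym : symmetric susp_rel'.
Proof.
by move=> a b; rewrite /susp_rel' eq_sym; congr [|| _, _ | _]; rewrite andbC.
Qed.

Fact susp_rel_trans : transitive susp_rel'.
Proof.
move=> b a c; rewrite /susp_rel'.
case/or3P=> [/eqP-> //|/andP[/eqP a0 /eqP b0]|/andP[/eqP a1 /eqP b1]].
- case/or3P=> [/eqP<-|/andP[_ /eqP c0]|/andP[/eqP b1 _]].
  + by rewrite a0 b0 !eqxx orbT.
  + by rewrite a0 c0 !eqxx orbT.
  + by move: (@zero_one_neq I); rewrite -b0 -b1 eqxx.
- case/or3P=> [/eqP<-|/andP[/eqP b0 _]|/andP[_ /eqP c1]].
  + by rewrite a1 b1 !eqxx !orbT.
  + by move: (@zero_one_neq I); rewrite -b0 -b1 eqxx.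
  + by rewrite a1 c1 !eqxx !orbT.
Qed.

Definition susp_rel := EquivRel _ susp_rel_refl susp_rel_sym susp_rel_trans.

Definition suspension : topologicalType :=
  quotient_topology {eq_quot susp_rel}%qT.

End suspension.

Section LS_category.
Context (R : realType) (X : topologicalType).

Definition contractible_in (U : set X) : Prop :=
  null_homotopic R (set_val : set_type U -> X).

Definition LS_cover (m : nat) : Prop :=
  exists U : 'I_m -> set X,
    [/\ forall i, open (U i), \bigcup_i U i = [set: X]
      & forall i, contractible_in (U i)].

(* [None] stands for an infinite category. *)
Definition LS_cat : option nat :=
  if pselect (exists m, `[< LS_cover m >]) is left ex_cover
  then Some (ex_minn ex_cover) else None.

End LS_category.

(* Main.v *)
Require Import Defs.
From mathcomp Require Import all_boot all_order all_algebra generic_quotient.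
From mathcomp Require Import perm.
From mathcomp Require Import all_classical all_reals.
From mathcomp Require Import topology normedtype homotopy.
From mathcomp Require Import ring lra zify.

(** Write F for the configuration space of k points of M.  The suspension of F
is the union of two open cones, each of which slides to its pole inside the
suspension, so its category is at most 2 (suspension_cover).  The category is
not 0 because F is nonempty, and it is 1 only if the suspension is
contractible.  The substance of the theorem is therefore
suspension_configuration_not_contractible, proved by a Borsuk-Ulam argument
instead of a computation of homology.

Exchanging the first two points of a configuration is a free involution of F.
Combined with the reflection t |-> 1 - t, it gives a free involution tau of the
whole suspension: the reflection exchanges the poles and acts on the equator
t = 1/2 by the exchange of points.

If the suspension were contractible, then it would receive equivariant maps
from the antipodal spheres of all dimensions (odd_sphere_map): once a sphere is
mapped, the contraction extends the map over one hemisphere of the next sphere,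
and tau dictates it on the other.  By the Borsuk-Ulam theorem, any d odd
real functions on the suspension would then vanish simultaneously somewhere on a
compact set C depending on d only (contractible_common_zero).

On the other hand, F has finite dimension, and this bounds the number of odd
functions needed to have no common zero.  If K is a compact subset of M * M
disjoint from the diagonal, then there are 2n+1 continuous functions on M * M,
odd for the exchange of coordinates, with no common zero on K
(off_diagonal_map).  Take for K the first two points of the configurations at
which C meets the equator, multiply these functions by t (1 - t), and add the
odd function t - 1/2: these 2n+2 functions have no common zero on C, a
contradiction.  It is essential that the number 2n+2 does not depend on C.

The functions of off_diagonal_map are found by a general position argument that
needs no smooth structure.  In a chart of dimension D, a continuous function
can be perturbed by collapsing a fine grid of cubes to points, except in thin
walls between the cubes, so that it takes finitely many values off the walls;
a small translation then makes all these values nonzero.  The grids used for the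
D+1 functions are offset from each other in such a way that no point lies in
walls of all of them (collapse_wall_free).  Treating one by one the finitely
many charts that cover K, with smaller and smaller perturbations, preserves what
was already achieved.

The Borsuk-Ulam theorem itself is proved with chains and cochains modulo 2 on
the sphere.  There is a d-chain c, made of arbitrarily small simplices, which is
a hemisphere of the d-sphere; for odd functions chi_1, ..., chi_d with
values in bool, the cup product of their coboundaries takes the value 1 on c
(sphere_chain).  Some small simplex v_0 ... v_d thus satisfies
chi_i v_(i-1) <> chi_i v_i for all i.  If d odd real functions had no common
zero, then one of them would have constant sign on this simplex, and its sign
cannot serve as chi_i. *)

Set Implicit Arguments.
Unset Strict Implicit.
Unset Printing Implicit Defensive.

Import Order.TTheory GRing.Theory Num.Theory.
Import numFieldNormedType.Exports.

(** * Chains and cup products modulo 2 *)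

Section chains.
Implicit Types T U : Type.

(** A simplex is the list of its vertices, a chain is a list of simplices
counted modulo 2, and a cochain is an arbitrary function of the list of
vertices. Two chains are only ever compared through their values on all
cochains. *)
Definition eval_chain T (a : seq T -> bool) (c : seq (seq T)) : bool :=
  \big[addb/false]_(s <- c) a s.

(** The complex is augmented: the only face of a vertex is the empty list.
*)
Fixpoint faces T (s : seq T) : seq (seq T) :=
  if s is x :: s' then s' :: [seq x :: q | q <- faces s'] else [::].

Definition boundary T (c : seq (seq T)) := flatten (map (@faces T) c).

Definition is_cycle T (c : seq (seq T)) :=
  forall a, eval_chain a (boundary c) = false.

(** Triangulation of the prism between the images of a simplex under f and
g. *)
Fixpoint prism T U (f g : T -> U) (s : seq T) : seq (seq U) :=
  if s is x :: s' then
    (f x :: g x :: map g s') :: [seq f x :: p | p <- prism f g s']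
  else [::].

(** The cup product of the coboundaries of the 0-cochains chi_1, ..., chi_d.
*)
Fixpoint cup T (chis : seq (T -> bool)) (s : seq T) : bool :=
  match chis, s with
  | [::], _ => true
  | chi :: chis', u :: ((v :: _) as s') =>
      (chi u (+) chi v) && cup chis' s'
  | _, _ => false
  end.

Lemma eval_chain_cons T a (s : seq T) c :
  eval_chain a (s :: c) = a s (+) eval_chain a c.
Proof. by rewrite /eval_chain big_cons. Qed.

Lemma eval_chain_nil T a : eval_chain a (Nil (seq T)) = false.
Proof. by rewrite /eval_chain big_nil. Qed.

Lemma eval_chain_cat T a (c1 c2 : seq (seq T)) :
  eval_chain a (c1 ++ c2) = eval_chain a c1 (+) eval_chain a c2.
Proof. by rewrite /eval_chain big_cat. Qed.

Lemma eval_chain_map T U a (f : seq T -> seq U) c :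
  eval_chain a (map f c) = eval_chain (a \o f) c.
Proof. by rewrite /eval_chain big_map. Qed.

Lemma eval_chain_flatten T U a (f : seq T -> seq (seq U)) c :
  eval_chain a (flatten (map f c)) = eval_chain (eval_chain a \o f) c.
Proof.
elim: c => [|s c IH] /=; first by rewrite !eval_chain_nil.
by rewrite eval_chain_cat IH eval_chain_cons.
Qed.

Lemma eval_chainD T (a b : seq T -> bool) c :
  eval_chain (fun s => a s (+) b s) c = eval_chain a c (+) eval_chain b c.
Proof. by rewrite /eval_chain big_split. Qed.

Lemma eval_chainM T b (a : seq T -> bool) c :
  eval_chain (fun s => b && a s) c = b && eval_chain a c.
Proof.
elim: c => [|s c IH]; first by rewrite !eval_chain_nil andbF.
by rewrite !eval_chain_cons IH andb_addr.
Qed.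

Lemma eq_eval_chain T (a b : seq T -> bool) c :
  a =1 b -> eval_chain a c = eval_chain b c.
Proof. by move=> ab; apply: eq_bigr => s _. Qed.

Lemma eq_in_eval_chain (T : eqType) (a b : seq T -> bool) (c : seq (seq T)) :
  {in c, a =1 b} -> eval_chain a c = eval_chain b c.
Proof. by move=> ab; apply: eq_big_seq => s /ab. Qed.

Lemma eval_chain_faces_cons T a (x : T) s :
  eval_chain a (faces (x :: s)) = a s (+) eval_chain (a \o cons x) (faces s).
Proof. by rewrite /= eval_chain_cons eval_chain_map. Qed.

Lemma faces_map T U (f : T -> U) s : faces (map f s) = map (map f) (faces s).
Proof.
elim: s => //= x s ->; congr cons.
by rewrite -!map_comp; apply: eq_map => q.
Qed.

Lemma boundary_map T U (f : T -> U) c :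
  boundary (map (map f) c) = map (map f) (boundary c).
Proof.
rewrite /boundary map_flatten -!map_comp; congr flatten.
by apply: eq_map => s /=; rewrite faces_map.
Qed.

Lemma boundary_cat T (c1 c2 : seq (seq T)) :
  boundary (c1 ++ c2) = boundary c1 ++ boundary c2.
Proof. by rewrite /boundary map_cat flatten_cat. Qed.

Lemma eval_prism_cons T U (f g : T -> U) a x s :
  eval_chain a (prism f g (x :: s)) =
  a (f x :: g x :: map g s) (+) eval_chain (a \o cons (f x)) (prism f g s).
Proof. by rewrite /= eval_chain_cons eval_chain_map. Qed.


(** The prism between f and g is a chain homotopy. Cutting off the first
vertex gives a recursion in which the same statement is needed for the
cochain restricted to simplices starting at f x. *)
Lemma boundary_prism T U (f g : T -> U) a s :
  eval_chain a (boundary (prism f g s)) (+)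
  eval_chain a (flatten (map (prism f g) (faces s))) =
  a (map f s) (+) a (map g s).
Proof.
rewrite /boundary; elim: s a => [|x s IH] a.
  by rewrite /= !eval_chain_nil !addbb.
have {}IH := IH (a \o cons (f x)).
rewrite !eval_chain_flatten in IH *.
rewrite eval_prism_cons eval_chain_faces_cons /comp /=.
rewrite (@eq_eval_chain _ _ (fun q => a q (+)
  eval_chain (fun y => a (f x :: y)) (faces q)) (prism f g s)); last first.
  by move=> q; rewrite eval_chain_cons eval_chain_map.
rewrite (@eq_eval_chain _ (fun q => eval_chain a _) (fun q =>
   a (f x :: g x :: map g q) (+)
  eval_chain (fun y => a (f x :: y)) (prism f g q)) (faces s)); last first.
  by move=> q; rewrite eval_chain_cons eval_chain_map.
rewrite !eval_chainD !eval_chain_cons !eval_chain_map faces_map eval_chain_map.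
rewrite /comp /= in IH *.
move: IH.
set b1 := a (f x :: map g s); set b2 := a (g x :: map g s).
set b3 := eval_chain _ (faces s).
set b4 := eval_chain a (prism f g s).
set b5 := eval_chain _ (prism f g s).
set b6 := eval_chain _ (faces s).
set b7 := a _.
by case: b1; case: b2; case: b3; case: b4; case: b5; case: b6; case: b7.
Qed.

Definition prism_chain T U (f g : T -> U) (c : seq (seq T)) :=
  flatten (map (prism f g) c).

Lemma boundary_prism_chain T U (f g : T -> U) c a : is_cycle c ->
  eval_chain a (boundary (prism_chain f g c)) =
  eval_chain (a \o map f) c (+) eval_chain (a \o map g) c.
Proof.
move=> cyc; rewrite -eval_chainD.
have := cyc (eval_chain a \o prism f g); rewrite -eval_chain_flatten => cyc0.
rewrite -[RHS]addbF -cyc0.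
rewrite /boundary /prism_chain; elim: c {cyc cyc0} => [|s c IH] /=.
  by rewrite !eval_chain_nil.
rewrite !(map_cat, flatten_cat, eval_chain_cat) IH eval_chain_cons.
rewrite -boundary_prism /boundary.
set b1 := eval_chain _ _; set b2 := eval_chain _ _; set b3 := eval_chain _ _.
set b4 := eval_chain _ _.
by case: b1; case: b2; case: b3; case: b4.
Qed.

Fixpoint homotopy_chain T U (h : nat -> T -> U) (N : nat) (c : seq (seq T)) :=
  if N is N'.+1 then
    homotopy_chain h N' c ++ prism_chain (h N') (h N) c
  else [::].

(** On a cycle, the prisms over the boundary vanish, so that the prisms
between consecutive maps add up to a chain whose boundary is the difference
of the two extreme images. *)
Lemma boundary_homotopy_chain T U (h : nat -> T -> U) N c a : is_cycle c ->
  eval_chain a (boundary (homotopy_chain h N c)) =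
  eval_chain (a \o map (h 0)) c (+) eval_chain (a \o map (h N)) c.
Proof.
move=> cyc; elim: N => [|N IH]; first by rewrite eval_chain_nil addbb.
rewrite /= boundary_cat eval_chain_cat IH boundary_prism_chain//.
by rewrite addbA -[X in X (+) _]addbA addbb addbF.
Qed.


Lemma cup_map T U (f : T -> U) chis s :
  cup chis (map f s) = cup [seq chi \o f | chi <- chis] s.
Proof.
elim: chis s => // chi chis IH [|u [|v s]] //=.
by rewrite -IH.
Qed.

(** Coboundaries are cocycles, and the cup product of cocycles is a cocycle.
*)
Lemma cup_cocycle T (chis : seq (T -> bool)) s :
  size s = (size chis).+2 -> eval_chain (cup chis) (faces s) = false.
Proof.
elim: chis s => [|chi chis IH] [|u [|v s]]//.
  by case: s => // _; rewrite /eval_chain /= !big_cons big_nil.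
case: s => // w s /= [sz].
have := IH (v :: w :: s); rewrite /= sz => /(_ erefl).
rewrite !eval_chain_cons !eval_chain_map /comp /=.
rewrite eval_chainM.
set b1 := cup _ (w :: s); set b2 := eval_chain _ _; set b3 := cup _ (v :: s).
by case: b1; case: b2; case: b3; case: (chi u); case: (chi v); case: (chi w).
Qed.

(** The instance of the Leibniz rule that lets Stokes' formula lower the
degree: one more coboundary factor is the coboundary of chi times a cocycle.
*)
Lemma cup_coboundary T (x0 : T) chi (chis : seq (T -> bool)) s :
  size s = (size chis).+2 ->
  eval_chain (fun q => chi (head x0 q) && cup chis q) (faces s) =
  cup (chi :: chis) s.
Proof.
case: s => [|u [|v s]]// sz; have := cup_cocycle sz.
rewrite !eval_chain_faces_cons /comp /= eval_chainM.
set b2 := eval_chain _ _; set b1 := cup _ _.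
by case: b1; case: b2; case: (cup chis (u :: s)); case: (chi u); case: (chi v).
Qed.

Lemma prism_sub (T U : eqType) (f g : T -> U) s p : p \in prism f g s ->
  size p = (size s).+1 /\
  forall u, u \in p -> exists2 x, x \in s & u = f x \/ u = g x.
Proof.
elim: s p => //= x s IH p; rewrite inE => /orP[/eqP->|/mapP[q /IH[sz qs] ->]].
  split=> [|u]; first by rewrite /= size_map.
  rewrite !inE => /or3P[/eqP->|/eqP->|/mapP[y ys ->]].
  - by exists x; [rewrite inE eqxx|left].
  - by exists x; [rewrite inE eqxx|right].
  - by exists y; [rewrite inE ys orbT|right].
split=> [|u]; first by rewrite /= sz.
rewrite inE => /orP[/eqP->|/qs[y ys h]].
  by exists x; [rewrite inE eqxx|left].
by exists y => //; rewrite inE ys orbT.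
Qed.

Lemma homotopy_chain_sub (T U : eqType) (h : nat -> T -> U) N c p :
  p \in homotopy_chain h N c ->
  exists i s, [/\ i < N, s \in c, size p = (size s).+1 &
  forall u, u \in p -> exists2 x, x \in s & u = h i x \/ u = h i.+1 x].
Proof.
elim: N => //= N IH; rewrite mem_cat => /orP[/IH[i [s [iN sc sz ps]]]|].
  by exists i, s; split=> //; exact: ltnW.
by move=> /flatten_mapP[s sc /prism_sub[sz ps]]; exists N, s.
Qed.
End chains.

(** * Chains of small simplices on spheres *)

Local Open Scope ring_scope.
Local Open Scope classical_set_scope.

Section mxnorm.
Context (R : realType).

Lemma mx_norm_leP m n (A : 'M[R]_(m, n)) (e : R) : 0 <= e ->
  reflect (forall i j, `|A i j| <= e) (`|A| <= e).
Proof.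
move=> e0; rewrite [`|A|]mx_normrE.
apply: (iffP (bigmax_leP _ _ _ _)) => [[_ h] i j|h].
  exact: (h (i, j)).
by split=> // -[i j] _; exact: h.
Qed.

Lemma mx_norm_ltP m n (A : 'M[R]_(m, n)) (e : R) : 0 < e ->
  reflect (forall i j, `|A i j| < e) (`|A| < e).
Proof.
move=> e0; rewrite [`|A|]mx_normrE.
apply: (iffP (bigmax_ltP _ _ _ _)) => [[_ h] i j|h].
  exact: (h (i, j)).
by split=> // -[i j] _; exact: h.
Qed.

Lemma mx_entry_le m n (A : 'M[R]_(m, n)) i j : `|A i j| <= `|A|.
Proof. by move: (lexx `|A|) => /(mx_norm_leP _ (normr_ge0 _)); exact. Qed.

Lemma norm_row_mx n1 n2 (a : 'rV[R]_n1) (b : 'rV[R]_n2) :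
  `|row_mx a b| = Num.max `|a| `|b|.
Proof.
apply/eqP; rewrite eq_le; apply/andP; split.
  apply/mx_norm_leP; first by rewrite le_max normr_ge0.
  move=> i j; rewrite mxE; case: splitP => k _; rewrite le_max.
    by apply/orP; left; exact: mx_entry_le.
  by apply/orP; right; exact: mx_entry_le.
rewrite ge_max; apply/andP; split; apply/mx_norm_leP => // i j.
  have := mx_entry_le (row_mx a b) i (lshift _ j).
  by rewrite row_mxEl.
have := mx_entry_le (row_mx a b) i (rshift _ j).
by rewrite row_mxEr.
Qed.

Lemma norm_scalar_mx1 (t : R) : `|t%:M : 'M_1| = `|t|.
Proof.
apply/eqP; rewrite eq_le; apply/andP; split.
  by apply/mx_norm_leP => // i j; rewrite !ord1 mxE eqxx mulr1n.
have := mx_entry_le (t%:M : 'M_1) ord0 ord0.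
by rewrite mxE eqxx mulr1n.
Qed.

End mxnorm.

Section spheres.
Context (R : realType).

Definition odd_fun (n : nat) (chi : 'rV[R]_n -> bool) :=
  forall v, v != 0 -> chi (- v) = ~~ chi v.

(** For t from 0 to 2, a homotopy in the unit sphere of the sup norm from
the inclusion of the equator to the constant map to the pole: the new
coordinate is raised to 1 along a vertical side of the cube, and the old
coordinates are then shrunk to 0 in its top face. *)
Definition cone_map n (t : R) (x : 'rV[R]_n) : 'rV[R]_(1 + n) :=
  row_mx (Num.min t 1)%:M (Num.min 1 (2 - t) *: x).

Lemma norm_cone_map n t (x : 'rV[R]_n) : 0 <= t <= 2 -> `|x| = 1 ->
  `|cone_map t x| = 1.
Proof.
move=> /andP[t0 t2] x1; rewrite norm_row_mx norm_scalar_mx1 normrZ x1 mulr1.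
case: (lerP t 1) => t1.
  rewrite [Num.min 1 _]min_l; last by lra.
  by rewrite normr1 max_r// ger0_norm.
rewrite normr1 max_l// ger0_norm ?ge_min ?lexx//.
by rewrite le_min ler01/= subr_ge0.
Qed.

(** On the sphere, the cone map is 1-Lipschitz in both variables, so that a
fine subdivision of [0, 2] turns small simplices into small prisms. *)
Lemma cone_map_dist n t t' (x y : 'rV[R]_n) : 0 <= t <= 2 -> 0 <= t' <= 2 ->
  `|x| = 1 -> `|cone_map t x - cone_map t' y| <= `|x - y| + `|t - t'|.
Proof.
move=> /andP[t0 t2] /andP[t'0 t'2] x1.
rewrite /cone_map opp_row_mx add_row_mx norm_row_mx ge_max; apply/andP; split.
  rewrite -raddfB norm_scalar_mx1; apply: (@le_trans _ _ `|t - t'|).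
    case: (lerP t 1) => ht; case: (lerP t' 1) => ht' //; rewrite ?subrr ?normr0//.
    - by rewrite ler0_norm ?ler0_norm; lra.
    - by rewrite ger0_norm ?ger0_norm; lra.
  by rewrite lerDr.
set r := Num.min _ _; set r' := Num.min _ _.
have r01 : `|r'| <= 1 by rewrite ger0_norm /r' ?le_min ?ge_min; lra.
have rr : `|r - r'| <= `|t - t'|.
  rewrite /r /r'; case: (lerP 1 (2 - t)) => ht; case: (lerP 1 (2 - t')) => ht' //.
  - by rewrite subrr normr0.
  - by rewrite ger0_norm ?ler0_norm; lra.
  - by rewrite ler0_norm ?ger0_norm; lra.
  - by rewrite (_ : _ - _ = - (t - t')) ?normrN//; ring.
have -> : r *: x - r' *: y = r' *: (x - y) + (r - r') *: x.
  by rewrite scalerBr scalerBl [RHS]addrC subrKA.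
apply: (le_trans (ler_normD _ _)); rewrite !normrZ x1 mulr1 lerD//.
by rewrite ler_piMl.
Qed.

(** The coboundary of an odd function is invariant under the antipode. *)
Lemma cup_odd n (chis : seq ('rV[R]_n -> bool)) s :
  (forall chi, chi \in chis -> odd_fun chi) ->
  (forall v, v \in s -> v != 0) -> cup chis (map -%R s) = cup chis s.
Proof.
elim: chis s => // chi chis IH [|u [|v s]] //= oc s0.
rewrite !oc ?inE ?eqxx ?s0 ?inE ?eqxx ?orbT// -[_ :: map _ _]/(map -%R (v :: s)).
rewrite IH; first by rewrite addbN addNb negbK.
- by move=> p pc; apply: oc; rewrite inE pc orbT.
- by move=> p ps; apply: s0; rewrite inE ps orbT.
Qed.

(** The chain c is a hemisphere of the j-sphere: together with its antipode
it is the fundamental cycle of the sphere. The next hemisphere is the cone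
on this cycle. By Stokes' formula, the value of the cup product on the cone
equals that of chi times the other factors on c and its antipode; the two
contributions differ by the value of the other factors on c, since chi is
odd, and this value is 1 by induction. *)
Lemma sphere_chain (j : nat) (eps : R) : 0 < eps ->
  exists c : seq (seq 'rV[R]_j.+1),
  [/\ forall s, s \in c -> [/\ size s = j.+1, forall u, u \in s -> `|u| = 1 &
        forall u v, u \in s -> v \in s -> `|u - v| <= eps],
     is_cycle (c ++ map (map -%R) c) &
     forall chis, size chis = j -> (forall chi, chi \in chis -> odd_fun chi) ->
       eval_chain (cup chis) c = true].
Proof.
elim: j eps => [|j IH] eps e0.
  exists [:: [:: const_mx 1]]; split.
  - move=> s; rewrite inE => /eqP->; split=> [//|u|u v]; rewrite !inE.
      move=> /eqP->; rewrite (_ : const_mx 1 = 1%:M) ?norm_scalar_mx1 ?normr1//.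
      by apply/matrixP => a b; rewrite !mxE !ord1.
    by move=> /eqP-> /eqP->; rewrite subrr normr0 ltW.
  - by move=> a; rewrite /boundary /= !eval_chain_cons eval_chain_nil addbF addbb.
  - by move=> [|//] _ _; rewrite eval_chain_cons eval_chain_nil.
have e2 : 0 < eps / 2 by rewrite divr_gt0.
have [c [cs cyc cupc]] := IH _ e2.
pose N := (Num.bound (4 / eps)).+1.
have N0 : 0 < N%:R :> R by rewrite ltr0n.
have N2 : 2 / N%:R <= eps / 2 :> R.
  rewrite ler_pdivrMr// mulrC -ler_pdivrMr//.
  rewrite (_ : 2 / (eps / 2) = 4 / eps); last by field; rewrite gt_eqF.
  apply: (@le_trans _ _ (Num.bound (4 / eps))%:R); last by rewrite ler_nat.
  by apply/ltW; rewrite archi_boundP// divr_ge0// ltW.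
(* The homotopy is sampled at times at most eps / 2 apart, and the mesh of c is
   at most eps / 2. *)
pose tt i : R := i%:R * (2 / N%:R).
pose h i (x : 'rV[R]_j.+1) : 'rV[R]_j.+2 := cone_map (tt i) x.
have tt02 i : (i <= N)%N -> 0 <= tt i <= 2.
  move=> iN; rewrite /tt mulr_ge0 ?divr_ge0//=.
  by rewrite mulrCA ger_pMr// ler_pdivrMr// mul1r ler_nat.
have ttS i : `|tt i.+1 - tt i| <= eps / 2.
  by rewrite /tt -mulrBl -natrB// subSnn mul1r ger0_norm// divr_ge0.
set c' := c ++ map (map -%R) c in cyc.
have c's s : s \in c' -> [/\ size s = j.+1, forall u, u \in s -> `|u| = 1 &
        forall u v, u \in s -> v \in s -> `|u - v| <= eps / 2].
  rewrite mem_cat => /orP[/cs//|/mapP[q /cs[sz q1 qe] ->]]; split.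
  - by rewrite size_map.
  - by move=> u /mapP[v /q1 v1 ->]; rewrite normrN.
  - move=> u v /mapP[u' u'q ->] /mapP[v' v'q ->].
    by rewrite -opprD normrN; exact: qe.
pose P := homotopy_chain h N c'.
pose iota (x : 'rV[R]_j.+1) : 'rV[R]_j.+2 := row_mx (0 : 'rV_1) x.
have iotaN x : iota (- x) = - iota x.
  apply/rowP => i; rewrite /iota !mxE; case: fintype.split => k; rewrite !mxE ?oppr0//.
have h0 x : h 0 x = iota x.
  rewrite /h /cone_map /tt mul0r subr0 min_l ?ler01// min_l ?ler1n//.
  by rewrite scale1r raddf0.
have hN x : h N x = row_mx (1%:M : 'M_1) 0.
  rewrite /h /cone_map /tt mulrCA mulfV ?gt_eqF// mulr1 subrr min_r ?ler1n//.
  by rewrite min_r// scale0r.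
(* The chain c and its antipode have the same image under the constant map
   h N, so that the contributions of the pole cancel. *)
have bP a : eval_chain a (boundary P) = eval_chain (a \o map iota) c'.
  rewrite boundary_homotopy_chain// [X in _ (+) X](_ : _ = false) ?addbF.
    by apply: eq_eval_chain => s /=; congr a; apply: eq_map => x.
  rewrite /c' eval_chain_cat eval_chain_map.
  rewrite (@eq_eval_chain _ _ ((a \o map (h N)) \o map -%R)) ?addbb//.
  by move=> s /=; congr a; rewrite -map_comp; apply: eq_map => x /=; rewrite !hN.
exists P; split.
- move=> s /homotopy_chain_sub[i [q [iN /c's[sz q1 qe] -> sq]]]; split.
  + by rewrite sz.
  + move=> u /sq[x /q1 x1 [->|->]]; apply: norm_cone_map => //; apply: tt02 => //.
    exact: ltnW.
  + move=> u v /sq[x xq hx] /sq[y yq hy].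
    have [k ki ->] : exists2 k, (k = i \/ k = i.+1) & u = h k x.
      by case: hx => ->; [exists i; [left|]|exists i.+1; [right|]].
    have [l li ->] : exists2 l, (l = i \/ l = i.+1) & v = h l y.
      by case: hy => ->; [exists i; [left|]|exists i.+1; [right|]].
    have kN : (k <= N)%N by case: ki => -> //; exact: ltnW.
    have lN : (l <= N)%N by case: li => -> //; exact: ltnW.
    have := cone_map_dist y (tt02 _ kN) (tt02 _ lN) (q1 _ xq).
    move=> /le_trans; apply; rewrite [leRHS]splitr lerD ?qe//.
    case: ki => ->; case: li => ->; rewrite ?subrr ?normr0 ?(ltW e2)//.
    by rewrite distrC.
- move=> a; rewrite boundary_cat boundary_map eval_chain_cat eval_chain_map !bP.
  rewrite /c' !eval_chain_cat !eval_chain_map.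
  rewrite [X in _ (+) (X (+) _)](_ : _ =
    eval_chain ((a \o map iota) \o map -%R) c); last first.
    apply: eq_eval_chain => s /=; rewrite -!map_comp.
    congr a; apply: eq_map => x /=.
    by rewrite iotaN.
  rewrite [X in _ (+) (_ (+) X)](_ : _ =
    eval_chain (a \o map iota) c); last first.
    apply: eq_eval_chain => s /=; rewrite -!map_comp.
    congr a; apply: eq_map => x /=.
    by rewrite iotaN opprK.
  by rewrite [X in _ (+) X]addbC addbb.
- case=> [//|chi chis] [szc] oc.
  have -> : eval_chain (cup (chi :: chis)) P =
     eval_chain (fun q => chi (head 0 q) && cup chis q) (boundary P).
    rewrite /boundary eval_chain_flatten; apply: eq_in_eval_chain => s.
    move=> /homotopy_chain_sub[i [q [iN /c's[sz _ _] ss _]]].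
    by apply/esym; apply: cup_coboundary; rewrite ss sz szc.
  rewrite bP /c' eval_chain_cat eval_chain_map -eval_chainD.
  have iota0 x : x != 0 -> iota x != 0.
    apply: contra => /eqP e; apply/eqP.
    by rewrite -[x](@row_mxKr _ _ 1 _ 0) -/(iota x) e linear0.
  rewrite -(cupc [seq p \o iota | p <- chis]) ?size_map//; last first.
    move=> p /mapP[q qc ->] v v0 /=.
    by rewrite iotaN oc ?inE ?qc ?orbT ?iota0.
  apply: eq_in_eval_chain => s /cs[sz s1 _] /=; rewrite -cup_map.
  have -> : map iota (map -%R s) = map -%R (map iota s).
    rewrite -!map_comp; apply: eq_map => x /=.
    by rewrite iotaN.
  have s0 v : v \in map iota s -> v != 0.
    move=> /mapP[x /s1 x1 ->]; apply: iota0.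
    by rewrite -normr_eq0 x1 oner_eq0.
  rewrite cup_odd//; last by move=> p pc; apply: oc; rewrite inE pc orbT.
  case: s sz s0 {s1} => // x s _ s0 /=.
  rewrite oc ?s0 ?inE ?eqxx//.
  by case: (chi _); case: (cup _ _).
Qed.
End spheres.

(** * The Borsuk-Ulam theorem *)

Section borsuk_ulam.
Context (R : realType).

Lemma compact_sphere n : compact [set v : 'rV[R]_n | `|v| = 1].
Proof.
apply: bounded_closed_compact.
  exists 1; split=> // x x1 v /= ->; exact: ltW.
rewrite (_ : [set _ | _] = (@Num.norm _ 'rV[R]_n) @^-1` [set x | x = 1])//.
apply: preimage_closed; last exact: (@closed_eq R 1).
by move=> v _; exact: norm_continuous.
Qed.

(** The first nonzero entry, or 0. Its sign is an odd function defined at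
all nonzero vectors; it decides the sign of a function at its zeros. *)
Definition lead_entry n (v : 'rV[R]_n) : R :=
  head 0 [seq x <- [seq v ord0 i | i <- enum 'I_n] | x != 0].

Lemma lead_entryN n (v : 'rV[R]_n) : lead_entry (- v) = - lead_entry v.
Proof.
rewrite /lead_entry.
have -> : [seq (- v) ord0 i | i <- enum 'I_n] =
    map -%R [seq v ord0 i | i <- enum 'I_n].
  by rewrite -[RHS]map_comp; apply: eq_map => i /=; rewrite mxE.
move: [seq v ord0 i | i <- enum 'I_n]; elim=> [|x s IH] /=; first by rewrite oppr0.
by rewrite oppr_eq0; case: ifP.
Qed.

Lemma lead_entry_neq0 n (v : 'rV[R]_n) : v != 0 -> lead_entry v != 0.
Proof.
apply: contra => /eqP l0; apply/eqP/rowP => i; rewrite mxE; apply/eqP.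
apply: contraT => vi; move: l0; rewrite /lead_entry.
have : v ord0 i \in [seq x <- [seq v ord0 i | i <- enum 'I_n] | x != 0].
  by rewrite mem_filter vi map_f// mem_enum.
case E : [seq _ <- _ | _] => [//|x s] _ /= x0.
have : x \in [seq x <- [seq v ord0 i | i <- enum 'I_n] | x != 0].
  by rewrite E inE eqxx.
by rewrite mem_filter x0 eqxx.
Qed.

Lemma cup_nth T (x0 : T) chi0 (chis : seq (T -> bool)) s i :
  cup chis s -> (i < size chis)%N ->
  (i.+1 < size s)%N /\
  nth chi0 chis i (nth x0 s i) != nth chi0 chis i (nth x0 s i.+1).
Proof.
elim: chis s i => // chi chis IH [|u [|v s]]// i /andP[uv cu].
case: i => [_|i ic] /=; first by split=> //; move: uv; case: (chi u); case: (chi v).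
by have [? ?] := IH _ i cu ic.
Qed.

(** A form of Lebesgue's number lemma: an index i that works for all pairs
of points near v can be chosen at a uniform scale. *)
Lemma lebesgue_number n (K : set 'rV[R]_n) (I : Type)
    (Q : I -> 'rV[R]_n -> 'rV[R]_n -> Prop) :
  compact K ->
  (forall v : 'rV[R]_n, K v -> exists i, exists2 r : R, 0 < r &
    forall w z : 'rV[R]_n, `|v - w| < r -> `|v - z| < r -> Q i w z) ->
  exists2 eta : R, 0 < eta & forall w : 'rV[R]_n, K w ->
    exists i, forall z : 'rV[R]_n, `|w - z| <= eta -> Q i w z.
Proof.
move=> /compact_near_coveringP cK locQ.
have H : \forall eta \near (0 : R)^'+, forall w : 'rV[R]_n, K w ->
    exists i, forall z : 'rV[R]_n, `|w - z| <= eta -> Q i w z.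
  apply: cK => v /locQ[i [r r0 rQ]].
  have r2 : 0 < r / 2 by rewrite divr_gt0.
  near=> w eta.
  have er : eta < r / 2 by near: eta; exact: nbhs_right_lt.
  have vw : `|v - w| < r / 2.
    have : ball v (r / 2) w by near: w; exact: nbhsx_ballx.
    by rewrite -ball_normE.
  exists i => z wz; apply: rQ.
    by apply: (lt_trans vw); rewrite ltr_pdivrMr// ltr_pMr// ltr1n.
  rewrite (splitr r) -[v](subrK w) -addrA; apply: (le_lt_trans (ler_normD _ _)).
  by rewrite ltrD// (le_lt_trans wz).
have /filter_ex[e [e0 He]] := @filterI _ _ (at_right_proper_filter (0 : R)) _ _
  (nbhs_right_gt (0 : R)) H.
by exists e.
Unshelve. all: by end_near. Qed.

Lemma constant_sign_scale n (I : Type) (f : I -> 'rV[R]_n -> R) :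
  (forall (v : 'rV[R]_n) i, v != 0 -> {for v, continuous (f i)}) ->
  (forall v, `|v| = 1 -> exists i, f i v != 0) ->
  exists2 eps : R, 0 < eps & forall w, `|w| = 1 ->
    exists i, forall z, `|w - z| <= eps -> 0 < f i w * f i z.
Proof.
move=> cf f0; apply: (lebesgue_number (@compact_sphere n)) => v /= v1.
have [i fi] := f0 _ v1.
have v0 : v != 0 by rewrite -normr_eq0 v1 oner_eq0.
have fi2 : 0 < f i v ^+ 2 by rewrite exprn_even_gt0.
have : \forall z \near v, 0 < f i v * f i z.
  have cfw : f i z @[z --> v] --> f i v := cf v i v0.
  have : f i v * f i z @[z --> v] --> f i v * f i v by exact: (cvgMl_tmp cfw).
  by move/cvgr_gt; apply; rewrite -expr2.
move=> /nbhs_ballP[r /= r0 rv]; exists i, r => // w z vw vz.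
have h1 : 0 < f i v * f i w by apply: rv; rewrite -ball_normE.
have h2 : 0 < f i v * f i z by apply: rv; rewrite -ball_normE.
by rewrite -(pmulr_rgt0 _ fi2) expr2 mulrACA mulr_gt0.
Qed.

(** At the scale of constant_sign_scale, each small simplex has an index i
for which f_i has constant sign on it. This contradicts the simplex given by
sphere_chain for the signs of the functions f_i. *)
Theorem borsuk_ulam d (f : 'I_d -> 'rV[R]_d.+1 -> R) :
  (forall (v : 'rV[R]_d.+1) i, v != 0 -> {for v, continuous (f i)}) ->
  (forall v i, v != 0 -> f i (- v) = - f i v) ->
  exists2 v, `|v| = 1 & forall i, f i v = 0.
Proof.
move=> cf of_; apply: contrapT => noz.
have [v v1|eps eps0 Heps] := @constant_sign_scale _ _ f cf.
  apply: contrapT => nz; apply: noz; exists v => // i.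
  by apply: contrapT => fi; apply: nz; exists i; exact/eqP.
have [c [cs _ cupc]] := sphere_chain d eps0.
pose chi i v := (0 < f i v) || ((f i v == 0) && (0 < lead_entry v)).
have chi_odd i : odd_fun (chi i).
  move=> v v0; rewrite /chi of_// lead_entryN oppr_gt0 oppr_eq0 oppr_gt0.
  have := lead_entry_neq0 v0.
  by case: (ltgtP (f i v) 0) => //= _; case: (ltgtP (lead_entry v) 0).
pose chis := [seq chi i | i <- enum 'I_d].
have szchis : size chis = d by rewrite size_map size_enum_ord.
have [s sc cups] : exists2 s, s \in c & cup chis s.
  apply: contrapT => nos.
  have : eval_chain (cup chis) c = false.
    rewrite /eval_chain big_seq big1// => s sc.
    by apply/negbTE/negP => cups; apply: nos; exists s.
  by rewrite cupc// => _ /mapP[i _ ->]; exact: chi_odd.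
have [szs s1 se] := cs _ sc.
(* The first vertex of the simplex serves as the centre of a ball containing
   all the others. *)
have sh : head 0 s \in s by case: (s) szs => // x s' _; rewrite inE eqxx.
have [i Hi] := Heps _ (s1 _ sh).
have ic : (i < size chis)%N by rewrite szchis.
have [lts] := cup_nth 0 (chi i) cups ic.
rewrite (nth_map i) ?size_enum_ord// nth_ord_enum.
have chiE z : z \in s -> chi i z = (0 < f i (head 0 s)).
  move=> zs; have := Hi z (se _ _ sh zs); rewrite /chi.
  case: (ltgtP (f i (head 0 s)) 0) => h; rewrite ?(nmulr_rgt0 _ h) ?(pmulr_rgt0 _ h).
  - by move=> fz; rewrite (lt_gtF fz) (lt_eqF fz).
  - by move=> ->.
  - by rewrite h mul0r ltxx.
by rewrite !chiE ?eqxx ?mem_nth// (ltn_trans _ lts).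
Qed.

End borsuk_ulam.

(** * Staircase functions *)

Section cvg_minmax.
Context (R : realType) (T : Type) (F : set_system T) {FF : Filter F}.
Implicit Types (f g : T -> R) (a b : R).

Lemma cvg_maxr f g a b : f x @[x --> F] --> a -> g x @[x --> F] --> b ->
  Num.max (f x) (g x) @[x --> F] --> Num.max a b.
Proof.
move=> fa gb; rewrite maxr_absE; under eq_fun do rewrite maxr_absE.
by apply: cvgMr_tmp; apply: cvgD; [exact: cvgD|apply: cvg_norm; exact: cvgB].
Qed.

Lemma cvg_minr f g a b : f x @[x --> F] --> a -> g x @[x --> F] --> b ->
  Num.min (f x) (g x) @[x --> F] --> Num.min a b.
Proof.
move=> fa gb; rewrite minr_absE; under eq_fun do rewrite minr_absE.
by apply: cvgMr_tmp; apply: cvgB; [exact: cvgD|apply: cvg_norm; exact: cvgB].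
Qed.

End cvg_minmax.

Section staircase.
Context (R : realType) (d : nat).

(** A continuous approximation of the identity: over [k, k+1] it rises from
k to k+1 on the first d-th of the interval, called the wall, and then stays
there. *)
Definition staircase (t : R) : R :=
  (Num.floor t)%:~R + Num.min 1 (d%:R * (t - (Num.floor t)%:~R)).

Definition wall (t : R) : bool := 0 < t - (Num.floor t)%:~R < d%:R^-1.

Hypothesis d2 : (2 <= d)%N.

Let d0 : 0 < d%:R :> R. Proof. by rewrite ltr0n; lia. Qed.
Let d1 : 1 < d%:R :> R. Proof. by rewrite ltr1n; lia. Qed.

Lemma floor_frac (t : R) : 0 <= t - (Num.floor t)%:~R < 1.
Proof.
by have := floor_itv t; rewrite intrD subr_ge0 => /andP[-> h] /=; rewrite ltrBlDl.
Qed.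

Lemma staircase_dist t : `|staircase t - t| <= 1.
Proof.
rewrite /staircase; have /andP[h0 h1] := floor_frac t.
set u := t - _ in h0 h1 *.
have -> : (Num.floor t)%:~R + Num.min 1 (d%:R * u) - t = Num.min 1 (d%:R * u) - u.
  by rewrite /u; ring.
have ud : u <= d%:R * u by rewrite ler_peMl// ltW.
case: (lerP 1 (d%:R * u)) => h; rewrite ger0_norm; lra.
Qed.

Lemma staircase_int t : ~~ wall t -> exists z : int, staircase t = z%:~R.
Proof.
rewrite /wall /staircase; have /andP[h0 h1] := floor_frac t.
set u := t - _ in h0 h1 *; rewrite negb_and -!leNgt => /orP[h|h].
  have -> : u = 0 by apply/eqP; rewrite eq_le h h0.
  by rewrite mulr0 min_r// addr0; eexists.
rewrite min_l; first by exists (Num.floor t + 1); rewrite intrD.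
by rewrite -ler_pdivrMl// mulr1.
Qed.

(** The definition by cases on the integral part is glued near t from a
single ramp formula, valid from the flat part before the integral part of t
up to the next integer. *)
Lemma staircase_continuous : continuous staircase.
Proof.
move=> t; pose k : R := (Num.floor t)%:~R.
pose f (s : R) := k + Num.max 0 (Num.min 1 (d%:R * (s - k))).
have /andP[h0 h1] := floor_frac t; rewrite -/k in h0 h1.
have dV1 : d%:R^-1 < 1 :> R by rewrite invf_lt1.
have E : \forall s \near t, staircase s = f s.
  near=> s.
  have sl : k - 1 + d%:R^-1 < s.
    by near: s; apply: lt_nbhsr; lra.
  have sr : s < k + 1 by near: s; apply: lt_nbhsl; lra.
  rewrite /f /staircase; case: (lerP k s) => ks.
    have -> : Num.floor s = Num.floor t.
      by apply: floor_def; rewrite intrD -/k ks.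
    rewrite -/k max_r// le_min ler01/= mulr_ge0// ?subr_ge0//; exact: ltW.
  have dV0 : 0 < d%:R^-1 :> R by rewrite invr_gt0.
  have -> : Num.floor s = Num.floor t - 1.
    by apply: floor_def; rewrite subrK intrB -/k ks andbT; lra.
  rewrite intrB -/k min_l; last first.
    by rewrite -ler_pdivrMl// mulr1; lra.
  rewrite subrK max_l ?addr0// ge_min; apply/orP; right.
  by rewrite pmulr_rle0// subr_le0 ltW.
have cf : f s @[s --> t] --> f t.
  apply: cvgD; first exact: cvg_cst.
  apply: cvg_maxr; first exact: cvg_cst.
  apply: cvg_minr; first exact: cvg_cst.
  by apply: cvgMl_tmp; apply: cvgB; [exact: cvg_id|exact: cvg_cst].
rewrite /continuous_at (nbhs_singleton E).
by apply: cvg_trans cf; apply: near_eq_cvg; near do apply/esym.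
Unshelve. all: by end_near. Qed.

(** The wall of the staircase shifted by i/d lies over the i-th of the d
equal parts of the unit interval, so that distinct shifts have disjoint
walls. *)
Lemma wall_shift_inj t (i j : nat) : (i < d)%N -> (j < d)%N ->
  wall (t - i%:R / d%:R) -> wall (t - j%:R / d%:R) -> i = j.
Proof.
move=> id jd; rewrite /wall.
set a := Num.floor _; set b := Num.floor _ => /andP[a0 a1] /andP[b0 b1].
have : `|(i%:Z + d%:Z * a - (j%:Z + d%:Z * b))%:~R| < 1 :> R.
  rewrite intrB !intrD !intrM -!pmulrn.
  have -> : i%:R + d%:R * a%:~R - (j%:R + d%:R * b%:~R) =
     d%:R * ((t - j%:R / d%:R - b%:~R) - (t - i%:R / d%:R - a%:~R)) :> R.
    by field; rewrite gt_eqF.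
  rewrite normrM gtr0_norm// -ltr_pdivlMl// mulr1.
  by rewrite ltr_norml; apply/andP; split; lra.
rewrite -intr_norm -[1]/(1%:~R) ltr_int => h.
have ab : i%:Z + d%:Z * a = j%:Z + d%:Z * b by lia.
case: (ltgtP a b) ab => [h1|h1|->]; [nia|nia|lia].
Qed.

End staircase.

Lemma avoid_finite (R : realType) (T : finType) (h : T -> R) (e : R) : 0 < e ->
  exists2 c, 0 < c <= e & forall t, h t != c.
Proof.
move=> e0; apply: contrapT => H.
have [j|f hf] := @choice 'I_#|T|.+1 T (fun j t => h t = e / (j.+1)%:R).
  apply: contrapT => nt; apply: H; exists (e / (j.+1)%:R).
    by rewrite divr_gt0//= ler_pdivrMr// ler_peMr ?ler1n// ltW.
  by move=> t; apply/eqP => ht; apply: nt; exists t.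
have : (#|'I_#|T|.+1| <= #|T|)%N.
  apply: (leq_card f) => i j fij; apply/val_inj/eqP.
  have : e / (i.+1)%:R = e / (j.+1)%:R by rewrite -!hf fij.
  move/(mulfI (lt0r_neq0 e0))/invr_inj/eqP.
  by rewrite eqr_nat eqSS.
by rewrite card_ord ltnn.
Qed.

(** * Collapsing the cubes of a grid *)

Section collapse.
Context (R : realType) (n : nat).
Let d := n.+2.

Lemma cvg_rV (T : Type) (F : set_system T) {FF : Filter F} (f : T -> 'rV[R]_n)
    (a : 'rV[R]_n) :
  (forall i, f x ord0 i @[x --> F] --> a ord0 i) -> f x @[x --> F] --> a.
Proof.
move=> fa; apply/cvgrPdist_lt => e e0.
have : \forall x \near F, forall i, `|a ord0 i - f x ord0 i| < e.
  by apply: filter_forall => i; have /cvgrPdist_lt := fa i; exact.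
by apply: filterS => x h; apply/mx_norm_ltP => // i j; rewrite !ord1 !mxE.
Qed.

Lemma cvg_entry (T : Type) (F : set_system T) {FF : Filter F} (f : T -> 'rV[R]_n)
    (a : 'rV[R]_n) i : f x @[x --> F] --> a -> f x ord0 i @[x --> F] --> a ord0 i.
Proof.
move=> fa; apply/cvgrPdist_lt => e e0.
move/cvgrPdist_lt : fa => /(_ _ e0); apply: filterS => x.
by apply: le_lt_trans; have := mx_entry_le (a - f x) ord0 i; rewrite !mxE.
Qed.

Definition collapse_wall (eta : R) (i : nat) (t : R) :=
  wall d (t / eta - i%:R / d%:R).

(** Applying a shifted staircase to each coordinate collapses each cube of a
grid of mesh eta to a vertex, except near the faces of the cubes. The index
i of the shift distinguishes n+1 grids; the shifts are multiples of 1/(n+2)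
so that the staircases have flat parts even if n = 0. *)
Definition collapse (eta : R) (i : nat) (v : 'rV[R]_n) : 'rV[R]_n :=
  \row_l (eta * (staircase d (v ord0 l / eta - i%:R / d%:R) + i%:R / d%:R)).

Lemma cvg_collapse (T : Type) (F : set_system T) {FF : Filter F}
    (f : T -> 'rV[R]_n) (a : 'rV[R]_n) eta i :
  f x @[x --> F] --> a -> collapse eta i (f x) @[x --> F] --> collapse eta i a.
Proof.
move=> fa; apply: cvg_rV => l.
rewrite mxE; under eq_fun do rewrite mxE.
have ch : f w ord0 l / eta - i%:R / d%:R @[w --> F]
    --> a ord0 l / eta - i%:R / d%:R.
  apply: cvgB; last exact: cvg_cst.
  by apply: cvgMr_tmp; exact: cvg_entry.
have cs := cvg_comp _ _ ch (@staircase_continuous R d isT _).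
by apply: cvgMl_tmp; apply: cvgD; [exact: cs|exact: cvg_cst].
Qed.

Variable eta : R.
Hypothesis eta0 : 0 < eta.

Lemma collapse_dist i v : `|v - collapse eta i v| <= eta.
Proof.
apply/mx_norm_leP; first exact: ltW.
move=> a l; rewrite !ord1 !mxE distrC.
set t := v ord0 l / eta - i%:R / d%:R.
have -> : eta * (staircase d t + i%:R / d%:R) - v ord0 l =
    eta * (staircase d t - t).
  by rewrite /t; field; rewrite pnatr_eq0 (gt_eqF eta0).
by rewrite normrM gtr0_norm// ger_pMr// staircase_dist.
Qed.

(** Off the walls the staircases take integer values, and these are bounded
on the unit ball. *)
Lemma collapse_finite (i : 'I_n.+1) :
  exists (T : finType) (h : T -> 'rV[R]_n), forall v : 'rV[R]_n,
  `|v| <= 1 -> (forall l, ~~ collapse_wall eta i (v ord0 l)) ->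
  exists t, collapse eta i v = h t.
Proof.
(* The coordinates of v / eta are at most 1 / eta; a shift and a staircase add
   at most 1 each. *)
pose B := (Num.bound (eta^-1)).+2.
pose f (w : {ffun 'I_n -> 'I_(B + B).+1}) : 'rV[R]_n :=
  \row_l (eta * ((w l)%:R - B%:R + i%:R / d%:R)).
exists {ffun 'I_n -> 'I_(B + B).+1}, f => v v1 nw.
suff [w wP] : {w : 'I_n -> 'I_(B + B).+1 & forall l,
    staircase d (v ord0 l / eta - i%:R / d%:R) = (w l)%:R - B%:R}.
  by exists [ffun l => w l]; apply/rowP => l; rewrite !mxE ffunE wP.
apply: (@choice _ _ (fun l w => staircase d (v ord0 l / eta - i%:R / d%:R) =
  (nat_of_ord w)%:R - B%:R)) => l.
have := nw l; rewrite /collapse_wall; set t := v ord0 l / eta - _ => /staircase_int.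
move=> /(_ isT)[z zE].
have vl : `|v ord0 l / eta| <= eta^-1.
  rewrite normrM normfV (gtr0_norm eta0) ler_piMl ?invr_ge0 ?(ltW eta0)//.
  exact: le_trans (mx_entry_le _ _ _) v1.
have id1 : (0 <= i%:R / d%:R :> R) && (i%:R / d%:R <= 1 :> R).
  apply/andP; split; first exact: divr_ge0.
  rewrite ler_pdivrMr ?ltr0n// mul1r ler_nat.
  by rewrite (leq_trans (ltnW (ltn_ord i))).
have zB : `|z%:~R| < B%:R :> R.
  have bB : eta^-1 < (Num.bound eta^-1)%:R :> R.
    by apply: archi_boundP; rewrite invr_ge0 ltW.
  have -> : B%:R = (Num.bound eta^-1)%:R + 2 :> R by rewrite /B -addn2 natrD.
  have := @staircase_dist R d isT t; rewrite zE /t.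
  move/ltr_normlP: (le_lt_trans vl bB) => [h1 h2].
  move=> /ler_normlP[h3 h4]; case/andP: id1 => h5 h6.
  by rewrite ltr_norml; apply/andP; split; lra.
have {}zB : `|z| < B%:Z by move: zB; rewrite -intr_norm -[B%:R]/(B%:Z%:~R) ltr_int.
exists (inord (absz (z + B%:Z))); rewrite inordK; last by lia.
rewrite zE pmulrn; have -> : (absz (z + B%:Z) : int) = z + B%:Z by lia.
by rewrite intrD -pmulrn addrK.
Qed.

(** General position: each of the n coordinates lies in a wall for at most
one of the n+1 grids, so that one grid has a wall containing none of them.
*)
Lemma collapse_wall_free (v : 'rV[R]_n) : exists i : 'I_n.+1,
  forall l, ~~ collapse_wall eta i (v ord0 l).
Proof.
apply: contrapT => H.
have [i|f hf] := @choice 'I_n.+1 'I_n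
    (fun i l => collapse_wall eta i (v ord0 l)).
  apply: contrapT => nl; apply: H; exists i => l.
  by apply/negP => wl; apply: nl; exists l.
have : (#|'I_n.+1| <= #|'I_n|)%N.
  apply: (leq_card f) => i j fij; apply/val_inj.
  apply: (@wall_shift_inj R d isT (v ord0 (f i) / eta)); first 2 last.
  - exact: hf.
  - by rewrite fij; exact: hf.
  - by apply: (leq_trans (ltn_ord i)).
  - by apply: (leq_trans (ltn_ord j)).
by rewrite !card_ord ltnn.
Qed.

End collapse.

(** * Perturbing functions in a chart *)

Section charts.
Context (R : realType).

(** A chart onto the ball of radius 3, with its inverse, both as total
functions. The radii 1 and 2 inside this ball leave room for a bump function
and for the displacement of points by a collapse. *)
Definition ball_chart n (X : topologicalType) (O : set X)
    (theta : X -> 'rV[R]_n) (zeta : 'rV[R]_n -> X) : Prop :=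
  [/\ open O,
      forall x, O x -> `|theta x| < 3 /\ zeta (theta x) = x,
      forall v, `|v| < 3 -> O (zeta v) /\ theta (zeta v) = v,
      forall x, O x -> {for x, continuous theta} &
      forall v : 'rV[R]_n, `|v| < 3 -> {for v, continuous zeta}].

Lemma compact_ball n (r : R) : compact [set v : 'rV[R]_n | `|v| <= r].
Proof.
apply: bounded_closed_compact.
  exists r; split; first exact: num_real.
  by move=> x rx v /= vr; apply: (le_trans vr); exact: ltW.
rewrite (_ : [set _ | _] = (@Num.norm _ 'rV[R]_n) @^-1` [set x | x <= r])//.
apply: preimage_closed; last exact: (@closed_le R r).
by move=> v _; exact: norm_continuous.
Qed.

Lemma uniform_oscillation n (I : finType) (F : I -> 'rV[R]_n -> R)
    (K : set 'rV[R]_n) (e : R) : 0 < e -> compact K ->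
  (forall (v : 'rV[R]_n) i, K v -> {for v, continuous (F i)}) ->
  exists2 eta : R, 0 < eta & forall w z : 'rV[R]_n, K w -> `|w - z| <= eta ->
    forall i, `|F i z - F i w| <= e.
Proof.
move=> e0 cK cF.
have [v Kv|eta eta0 He] := @lebesgue_number R n K unit
    (fun _ w z => forall i, `|F i z - F i w| <= e) cK; last first.
  by exists eta => // w z Kw wz; have [_] := He _ Kw; exact.
exists tt.
have : \forall z \near v, forall i, `|F i v - F i z| < e / 2.
  apply: (@filter_forall _ I (fun i z => `|F i v - F i z| < e / 2) (nbhs v)) => i.
  have cFv : F i z @[z --> v] --> F i v := cF v i Kv.
  by move/cvgrPdist_lt : cFv; apply; rewrite divr_gt0.
move=> /nbhs_ballP[r /= r0 rv]; exists r => // w z vw vz i.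
rewrite (splitr e) -[F i z](subrK (F i v)) -addrA.
apply: (le_trans (ler_normD _ _)); rewrite lerD//.
  by rewrite distrC ltW// rv// -ball_normE.
by rewrite ltW// rv// -ball_normE.
Qed.

(** The perturbation replaces g_i near the unit ball of the chart by its
composite with the i-th collapse, translated by a small constant that avoids
finitely many values; a bump function extends it by 0. Off the walls of the
i-th grid the result is nonzero, and every point is off the walls of some
grid. *)
Lemma chart_perturbation n (X : topologicalType) (O : set X)
    (theta : X -> 'rV[R]_n) (zeta : 'rV[R]_n -> X)
    (g : 'I_n.+1 -> X -> R) (e : R) :
  hausdorff_space X -> ball_chart O theta zeta ->
  (forall i, continuous (g i)) -> 0 < e ->
  exists u : 'I_n.+1 -> X -> R,
  [/\ forall i, continuous (u i), forall i x, `|u i x| <= e,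
      forall i x, ~ O x -> u i x = 0 &
      forall x, O x -> `|theta x| <= 1 -> exists i, g i x + u i x != 0].
Proof.
move=> hX [oO Oth Oze cth cze] cg e0.
have e2 : 0 < e / 2 by rewrite divr_gt0.
have lt23 (v : 'rV[R]_n) : `|v| <= 2 -> `|v| < 3.
  by move=> v2; apply: (le_lt_trans v2); rewrite ltr_nat.
have [|eta' eta'0 osc'] := @uniform_oscillation n 'I_n.+1
    (fun i => g i \o zeta) _ _ e2 (@compact_ball n 2).
  move=> v i /= v2; apply: continuous_comp; first exact/cze/lt23.
  exact: cg.
(* A collapse of mesh at most 1 / 2 keeps the ball of radius 2 inside the image
   of the chart. *)
pose eta := Num.min eta' (1 / 2).
have eta0 : 0 < eta by rewrite lt_min eta'0 divr_gt0.
have osc (v z : 'rV[R]_n) : `|v| <= 2 -> `|v - z| <= eta ->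
    forall i, `|g i (zeta z) - g i (zeta v)| <= e / 2.
  move=> v2 vz; apply: osc' => //; apply: (le_trans vz).
  by rewrite ge_min lexx.
have [c cP] : {c : 'I_n.+1 -> R & forall i, 0 < c i <= e / 2 /\
   forall v : 'rV[R]_n, `|v| <= 1 ->
     (forall l, ~~ collapse_wall n eta i (v ord0 l)) ->
     g i (zeta (collapse eta i v)) + c i != 0}.
  apply: (@choice _ _ (fun (i : 'I_n.+1) c => 0 < c <= e / 2 /\
   forall v : 'rV[R]_n, `|v| <= 1 ->
     (forall l, ~~ collapse_wall n eta i (v ord0 l)) ->
     g i (zeta (collapse eta i v)) + c != 0)) => i.
  have [T [h hP]] := collapse_finite eta0 i.
  have [c c0 cP] := avoid_finite (fun t => - g i (zeta (h t))) e2.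
  exists c; split=> // v v1 nw; have [t ->] := hP v v1 nw.
  by rewrite addrC -[g i _]opprK subr_eq0 eq_sym.
pose bump x := Num.max 0 (Num.min 1 (2 - `|theta x|)).
pose u i x := if x \in O then
  bump x * (g i (zeta (collapse eta i (theta x))) + c i - g i x) else 0.
have bump01 x : 0 <= bump x <= 1.
  by rewrite /bump le_max lexx/= ge_max ler01/= ge_min lexx.
have closed2 : closed (zeta @` [set v | `|v| <= 2]).
  apply: compact_closed => //; apply: continuous_compact; last exact: compact_ball.
  apply: continuous_in_subspaceT => v; rewrite inE /= => v2.
  exact/cze/lt23.
have u0 i x : ~ (zeta @` [set v | `|v| <= 2]) x -> u i x = 0.
  move=> nx; rewrite /u; case: ifPn => //; rewrite inE => Ox.
  rewrite /bump max_l ?mul0r// ge_min; apply/orP; right; rewrite subr_le0 leNgt.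
  apply/negP => th2; apply: nx; exists (theta x) => /=; first exact: ltW.
  by have [] := Oth _ Ox.
exists u; split.
(* The function u i is given by a formula that is continuous on the image of the
   closed ball of radius 2, and it vanishes on the open complement. *)
- move=> i x.
  have [[v /= v2 vx]|nx] := pselect ((zeta @` [set v | `|v| <= 2]) x).
    have [Ox thx] := Oze _ (lt23 _ v2); rewrite vx in Ox thx.
    pose w y := bump y * (g i (zeta (collapse eta i (theta y))) + c i - g i y).
    have nO : \forall y \near x, w y = u i y.
      have : nbhs x O by apply: open_nbhs_nbhs.
      by apply: filterS => y Oy; rewrite /u mem_set.
    rewrite /continuous_at -(nbhs_singleton nO).
    apply: cvg_trans (near_eq_cvg nO) _.
    have cx : theta y @[y --> x] --> theta x := cth _ Ox.
    apply: cvgM.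
      apply: cvg_maxr; first exact: cvg_cst.
      apply: cvg_minr; first exact: cvg_cst.
      apply: cvgB; first exact: cvg_cst.
      exact: cvg_norm.
    apply: cvgB; last exact: cg.
    apply: cvgD; last exact: cvg_cst.
    have c3 : `|collapse eta i (theta x)| < 3.
      rewrite thx -[collapse _ _ _](subrK v).
      apply: (le_lt_trans (ler_normD _ _)); rewrite distrC.
      have := collapse_dist eta0 i v; have : eta <= 1 / 2 by rewrite ge_min lexx orbT.
      by lra.
    have c1 : collapse eta i (theta y) @[y --> x] --> collapse eta i (theta x).
      exact: cvg_collapse cx.
    have c2 : {for collapse eta i (theta x), continuous (g i \o zeta)}.
      by apply: continuous_comp; [exact: cze|exact: cg].
    exact: (cvg_comp _ _ c1 c2).
  have nO : \forall y \near x, cst 0 y = u i y.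
    have : nbhs x (~` (zeta @` [set v | `|v| <= 2])).
      by apply: open_nbhs_nbhs; split=> //; exact: closed_openC.
    by apply: filterS => y ny; rewrite u0.
  rewrite /continuous_at -(nbhs_singleton nO).
  by apply: cvg_trans (near_eq_cvg nO) _; exact: cvg_cst.
- move=> i x.
  have [[v /= v2 vx]|nx] := pselect ((zeta @` [set v | `|v| <= 2]) x);
    last by rewrite u0// normr0 ltW.
  have [Ox thx] := Oze _ (lt23 _ v2); rewrite vx in Ox thx.
  rewrite /u mem_set// normrM; have /andP[b0 b1] := bump01 x.
  rewrite (ger0_norm b0); apply: (@le_trans _ _ (1 * `|g i (zeta
      (collapse eta i (theta x))) + c i - g i x|)); first exact: ler_wpM2r.
  rewrite mul1r addrAC (splitr e); apply: (le_trans (ler_normD _ _)).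
  apply: lerD; last by have [/andP[/ltW c0 ?] _] := cP i; rewrite ger0_norm.
  by rewrite thx -vx; apply: osc => //; exact: collapse_dist.
- move=> i x nOx; apply: u0 => -[v /= /lt23/Oze[Ov _] vx].
  by apply: nOx; rewrite -vx.
- move=> x Ox th1; have [i nw] := collapse_wall_free eta (theta x).
  exists i; have [_ /(_ _ th1 nw) gc0] := cP i; rewrite /u mem_set//.
  rewrite /bump min_l; last by lra.
  by rewrite max_r ?ler01// mul1r addrC subrK.
Qed.
End charts.

(** * Odd functions without common zeros on a compact set *)

Section odd_maps.
Context (R : realType) (X : topologicalType).

Lemma compact_lower_bound (N : set X) (f : X -> R) : compact N ->
  continuous f -> (forall x, N x -> 0 < f x) ->
  exists2 delta : R, 0 < delta & forall x, N x -> delta <= f x.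
Proof.
move=> /compact_near_coveringP cN cf f0.
have H : \forall delta \near (0 : R)^'+, N `<=` (fun x => delta <= f x).
  apply: cN => x Nx.
  have f2 : 0 < f x / 2 by rewrite divr_gt0// f0.
  have fy : \forall y \near x, f x / 2 <= f y.
    apply: (cvgr_ge (f x)); first exact: cf.
    by rewrite ltr_pdivrMr// ltr_pMr ?f0// ltr1n.
  near=> y delta.
  have df : delta <= f x / 2 by near: delta; exact: nbhs_right_ltW.
  have fxy : f x / 2 <= f y by near: y; exact: fy.
  exact: le_trans df fxy.
have /filter_ex[e [e0 He]] := @filterI _ _ (at_right_proper_filter (0 : R)) _ _
  (nbhs_right_gt (0 : R)) H.
by exists e.
Unshelve. all: by end_near. Qed.

(** The filter of finite lists ordered by inclusion turns the
characterization of compactness by near coverings into the extraction of a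
finite cover. *)
Lemma compact_finite_cover (K : set X) (N : X -> set X) : compact K ->
  (forall p, K p -> nbhs p (N p)) ->
  exists2 s : seq X, (forall p, p \in s -> K p) &
    forall x, K x -> exists2 p, p \in s & N p x.
Proof.
move=> /compact_near_coveringP cK nN.
pose F := filter_from [set: seq X] (fun s0 => [set s : seq X | {subset s0 <= s}]).
have FF : ProperFilter F.
  apply: filter_from_proper; last by move=> s _; exists s => /=.
  apply: filter_from_filter; first by exists [::].
  move=> s1 s2 _ _; exists (s1 ++ s2) => // s /= sub.
  by split=> x xs; apply: sub; rewrite mem_cat xs ?orbT.
have H : \forall s \near F,
    K `<=` (fun x => exists2 p, p \in s /\ K p & N p x).
  apply: cK => x Kx; exists (N x, [set s : seq X | x \in s]) => /=.
    by split; [exact: nN|exists [:: x] => // s /= sub; apply: sub; rewrite inE].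
  by move=> [y s] /= [Ny xs]; exists x.
have [s Ks] := @filter_ex _ F FF _ H.
exists [seq p <- s | `[< K p >]] => [p|x].
  by rewrite mem_filter => /andP[/asboolP].
move=> /Ks[p [ps Kp] Np]; exists p => //.
by rewrite mem_filter ps andbT; exact/asboolP.
Qed.

(** Induction on a finite list of charts that cover K. In the chart at p, a
function u from chart_perturbation is made odd by subtracting its composite
with sigma; this changes nothing on the chart, which is disjoint from its
image under sigma. The sum of the absolute values of the functions is
bounded below on the charts already treated, which tells how small the next
perturbation must be. *)
Lemma odd_nonvanishing n (sigma : X -> X) (K : set X) :
  hausdorff_space X -> continuous sigma -> involutive sigma -> compact K ->
  (forall p, K p -> exists O (theta : X -> 'rV[R]_n) zeta,
    [/\ ball_chart O theta zeta, O p, `|theta p| < 1 &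
        forall x, O x -> ~ O (sigma x)]) ->
  exists g : 'I_n.+1 -> X -> R,
  [/\ forall i, continuous (g i), forall i x, g i (sigma x) = - g i x &
      forall x, K x -> exists i, g i x != 0].
Proof.
move=> hX csigma sigmaK cK charts.
pose C (t : set X * (X -> 'rV[R]_n) * ('rV[R]_n -> X)) :=
  [set x | t.1.1 x /\ `|t.1.2 x| <= 1].
pose good (t : set X * (X -> 'rV[R]_n) * ('rV[R]_n -> X)) :=
  ball_chart t.1.1 t.1.2 t.2 /\ forall x, t.1.1 x -> ~ t.1.1 (sigma x).
have step (s : seq X) t : (forall p, p \in s -> good (t p)) ->
  exists (g : 'I_n.+1 -> X -> R) (delta : R),
  [/\ forall i, continuous (g i), forall i x, g i (sigma x) = - g i x, 0 < delta &
      forall p x, p \in s -> C (t p) x -> delta <= \sum_i `|g i x|].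
  elim: s => [_|p s IH good_s].
    exists (fun _ _ => 0), 1; split=> //.
    - by move=> i; exact: cst_continuous.
    - by move=> i x; rewrite oppr0.
  have [|g [delta [cg og d0 gd]]] := IH.
    by move=> q qs; apply: good_s; rewrite inE qs orbT.
  have [chp Op] := good_s p (mem_head _ _).
  (* Half of delta is shared among n+1 functions, each of which changes by the
     two terms u i x and u i (sigma x). *)
  have e0 : 0 < delta / 2 / n.+1%:R / 2 by rewrite !divr_gt0.
  have [u [cu ue uO gu]] := chart_perturbation hX chp cg e0.
  pose g' i x := g i x + (u i x - u i (sigma x)).
  have cg' i : continuous (g' i).
    move=> x; apply: cvgD; first exact: cg.
    apply: cvgB; first exact: cu.
    by apply: (cvg_comp sigma (u i)); [exact: csigma|exact: cu].
  have g'g i x : `|g i x| - delta / 2 / n.+1%:R <= `|g' i x|.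
    have := ler_normB (g' i x) (u i x - u i (sigma x)).
    rewrite /g' addrK; have := ler_normB (u i x) (u i (sigma x)).
    have := ue i x; have := ue i (sigma x).
    by move: (delta / 2 / n.+1%:R) => e; lra.
  have cC : compact (C (t p)).
    have [oO Oth Oze cth cze] := chp.
    rewrite (_ : C _ = (t p).2 @` [set v | `|v| <= 1]).
      apply: continuous_compact; last exact: compact_ball.
      apply: continuous_in_subspaceT => v; rewrite inE /= => v1.
      by apply: cze; apply: (le_lt_trans v1); rewrite ltr1n.
    apply/seteqP; split => [x [/Oth[_ xE] x1]|_ [v /= v1 <-]].
      by exists ((t p).1.2 x).
    have /Oze[Ov thv] : `|v| < 3 by apply: (le_lt_trans v1); rewrite ltr1n.
    by split => //=; rewrite thv.
  have [|x [Ox x1]|d' d'0 gd'] := @compact_lower_bound _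
      (fun x => \sum_i `|g' i x|) cC.
  - move=> x; apply: (@cvg_big R _ +%R 0) => [|i _]; first exact: add_continuous.
    by apply: cvg_norm; exact: cg'.
  - have [i gui] := gu x Ox x1.
    rewrite (bigD1 i)//= ltr_pwDl ?sumr_ge0// normr_gt0 /g'.
    by rewrite [u i (sigma x)]uO ?subr0//; exact: Op.
  exists g', (Num.min d' (delta / 2)); split => //.
  - move=> i x; rewrite /g' og sigmaK; ring.
  - by rewrite lt_min d'0 divr_gt0.
  - move=> q x; rewrite inE => /orP[/eqP->|qs] Cx.
      by rewrite ge_min gd'.
    rewrite ge_min; apply/orP; right.
    have -> : delta / 2 = delta - \sum_(i < n.+1) delta / 2 / n.+1%:R.
      rewrite sumr_const card_ord -[X in _ - X]mulr_natr divfK ?pnatr_eq0//; lra.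
    apply: (@le_trans _ _ (\sum_i (`|g i x| - delta / 2 / n.+1%:R))).
      by rewrite sumrB lerB// (gd q).
    by apply: ler_sum.
have [t tP] : {t : X -> set X * (X -> 'rV[R]_n) * ('rV[R]_n -> X) & forall p,
    K p -> [/\ good (t p), (t p).1.1 p & `|(t p).1.2 p| < 1]}.
  apply: (@choice _ _ (fun p t => K p -> [/\ good t, t.1.1 p & `|t.1.2 p| < 1])).
  move=> p; have [Kp|nKp] := pselect (K p).
    have [O [theta [zeta [? ? ? ?]]]] := charts p Kp.
    by exists (O, theta, zeta).
  by exists (setT, cst 0, cst p) => /nKp.
have [p Kp|s sK scov] := @compact_finite_cover K
    (fun p => [set x | (t p).1.1 x /\ `|(t p).1.2 x| < 1]) cK.
  have [[[oO Oth Oze cth cze] _] Op p1] := tP p Kp.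
  apply: filterI; first by apply: open_nbhs_nbhs.
  have cp : (t p).1.2 y @[y --> p] --> (t p).1.2 p := cth _ Op.
  by move/cvgr_norm_lt : cp; exact.
have [p /sK Kp|g [delta [cg og d0 gd]]] := step s t; first by have [] := tP p Kp.
exists g; split=> // x /scov[p ps [Ox x1]].
apply: contrapT => ng; have := gd p x ps (conj Ox (ltW x1)).
rewrite big1 ?leNgt ?d0// => i _.
by apply/eqP; rewrite normr_eq0; apply: contraT => gi; case: ng; exists i.
Qed.
End odd_maps.

(** * Charts of manifolds and of their squares *)

Lemma hausdorff_prod (S T : topologicalType) : hausdorff_space S ->
  hausdorff_space T -> hausdorff_space (S * T)%type.
Proof.
move=> hS hT [p1 p2] [q1 q2] pq; congr pair.
  apply: hS => A B pA qB.
  have [[x y] [[/= Ax _] [/= Bx _]]] :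
      (A `*` [set: T]) `&` (B `*` [set: T]) !=set0.
    by apply: pq; [exists (A, setT)|exists (B, setT)] => //=; split => //; exact: filterT.
  by exists x.
apply: hT => A B pA qB.
have [[x y] [[/= _ Ax] [/= _ Bx]]] :
    ([set: S] `*` A) `&` ([set: S] `*` B) !=set0.
  by apply: pq; [exists (setT, A)|exists (setT, B)] => //=; split => //; exact: filterT.
by exists y.
Qed.

(** Since U is open, continuity for the subspace topology of U is continuity
at its points. *)
Lemma continuous_insubd (X Z : topologicalType) (U : set X) (u0 : set_type U)
    (h : set_type U -> Z) : open U -> continuous h ->
  forall x, U x -> {for x, continuous (h \o insubd u0)}.
Proof.
move=> oU ch x Ux W /= hW.
have vi y : U y -> set_val (insubd u0 y) = y.
  by move=> Uy; apply: insubdK; rewrite inE.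
have := ch (insubd u0 x) W hW.
case=> B' [[B oB <-] /= Bx] sub.
rewrite vi// in Bx.
have nBU : nbhs x (B `&` U).
  by apply: filterI; apply: open_nbhs_nbhs.
apply: filterS nBU => y [By Uy]; apply: sub => /=.
by rewrite vi.
Qed.

Section manifold_charts.
Context (R : realType).

Lemma cvg_affine n (T : Type) (F : set_system T) {FF : Filter F}
    (f : T -> 'rV[R]_n) (a c : 'rV[R]_n) (r : R) :
  f x @[x --> F] --> a -> c + r *: f x @[x --> F] --> c + r *: a.
Proof.
by move=> fa; apply: cvgD; [exact: cvg_cst|apply: cvgZl_tmp].
Qed.

Lemma manifold_chart n (M : topologicalType) (p : M) (W : set M) :
  locally_euclidean R n M -> open W -> W p ->
  exists (O : set M) (theta : M -> 'rV[R]_n) zeta,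
    [/\ ball_chart O theta zeta, O p, theta p = 0 & O `<=` W].
Proof.
move=> /(_ p)[U [V [oU Up oV [f [g [cf cg fgK gfK]]]]]] oW Wp.
pose p' : set_type U := Sub p (mem_set Up).
pose c' := f p'; pose c : 'rV[R]_n := val c'.
pose F : M -> 'rV[R]_n := val \o (f \o insubd p').
pose G : 'rV[R]_n -> M := val \o (g \o insubd c').
have cval (T : topologicalType) (A : set T) : continuous (val : set_type A -> T).
  exact: initial_continuous.
have Vc : V c by exact: set_mem (valP c').
have cF x : U x -> {for x, continuous F}.
  move=> Ux; apply: continuous_comp; last exact: cval.
  exact: continuous_insubd.
have cG v : V v -> {for v, continuous G}.
  move=> Vv; apply: continuous_comp; last exact: cval.
  exact: continuous_insubd.
have Gc : G c = p by rewrite /G /= valKd fgK.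
have FU x : U x -> V (F x) /\ G (F x) = x.
  move=> Ux; split; first exact: set_mem (valP _).
  by rewrite /G /F /= valKd fgK insubdK// inE.
have GV v : V v -> U (G v) /\ F (G v) = v.
  move=> Vv; split; first exact: set_mem (valP _).
  by rewrite /G /F /= valKd gfK insubdK// inE.
have [e /= e0 eV] : exists2 e : R, 0 < e & forall v, `|c - v| < e -> V v /\ W (G v).
  have nVW : nbhs c (V `&` G @^-1` W).
    apply: filterI; first by apply: open_nbhs_nbhs.
    by apply: (cG _ Vc); rewrite Gc; apply: open_nbhs_nbhs.
  have /nbhs_ballP[e e0 he] := nVW.
  by exists e => // v ve; apply: he; rewrite -ball_normE.
pose r := e / 3; have r0 : 0 < r by rewrite divr_gt0.
pose theta x := r^-1 *: (F x - c); pose zeta v := G (c + r *: v).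
have Vr v : `|v| < 3 -> V (c + r *: v) /\ W (zeta v).
  move=> v3; apply: eV; rewrite opprD addrA subrr sub0r normrN normrZ gtr0_norm//.
  by rewrite /r mulrAC ltr_pdivrMr// ltr_pM2l.
have thze v : `|v| < 3 -> theta (zeta v) = v.
  move=> /Vr[/GV[_ FG] _]; rewrite /theta /zeta FG addrAC subrr add0r.
  by rewrite scalerA mulVf ?gt_eqF// scale1r.
have zeth x : U x -> zeta (theta x) = x.
  move=> Ux; rewrite /theta /zeta scalerA mulfV ?gt_eqF// scale1r addrC subrK.
  by have [] := FU _ Ux.
have cth x : U x -> {for x, continuous theta}.
  move=> Ux; have cFx : F y @[y --> x] --> F x := cF x Ux.
  have : theta y @[y --> x] --> theta x.
    by apply: cvgZl_tmp; apply: cvgB => //; exact: cvg_cst.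
  exact.
have thp : theta p = 0.
  have -> : theta p = r^-1 *: (F p - c) by [].
  have -> : F p = c by rewrite /F /= (valKd p' p' : insubd p' p = p').
  by rewrite subrr scaler0.
exists [set x | U x /\ `|theta x| < 3], theta, zeta; split.
- split.
  + rewrite openE => x [/= Ux x3]; apply: filterI; first by apply: open_nbhs_nbhs.
    have cx : theta y @[y --> x] --> theta x := cth _ Ux.
    by move/cvgr_norm_lt : cx; exact.
  + by move=> x [Ux x3]; rewrite zeth.
  + move=> v v3; rewrite thze//; split=> //; split; last by rewrite thze.
    by have [/GV[]] := Vr _ v3.
  + by move=> x [Ux _]; exact: cth.
  + move=> v v3; apply: continuous_comp; last by apply: cG; have [] := Vr _ v3.
    exact: (@cvg_affine _ _ (nbhs v) _ id _ _ _ cvg_id).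
- by split; rewrite ?thp ?normr0.
- by [].
- by move=> x [Ux /Vr[_]]; rewrite zeth.
Qed.

Lemma prod_chart n1 n2 (X1 X2 : topologicalType) (O1 : set X1) (O2 : set X2)
    (theta1 : X1 -> 'rV[R]_n1) (theta2 : X2 -> 'rV[R]_n2) zeta1 zeta2 :
  ball_chart O1 theta1 zeta1 -> ball_chart O2 theta2 zeta2 ->
  ball_chart (O1 `*` O2) (fun x => row_mx (theta1 x.1) (theta2 x.2))
    (fun v => (zeta1 (lsubmx v), zeta2 (rsubmx v))).
Proof.
move=> [oO1 th1 ze1 cth1 cze1] [oO2 th2 ze2 cth2 cze2].
have sub3 (v : 'rV[R]_(n1 + n2)) : `|v| < 3 -> `|lsubmx v| < 3 /\ `|rsubmx v| < 3.
  by rewrite -{1}[v]hsubmxK norm_row_mx gt_max => /andP.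
split.
- rewrite openE => -[x y] [/= O1x O2y]; exists (O1, O2) => //=.
  by split; apply: open_nbhs_nbhs.
- move=> [x y] [/= /th1[x3 xE] /th2[y3 yE]].
  by rewrite norm_row_mx gt_max x3 y3 row_mxKl row_mxKr xE yE.
- move=> v /sub3[/ze1[o1 e1] /ze2[o2 e2]]; split => //=.
  by rewrite e1 e2 hsubmxK.
- move=> [x y] [/= O1x O2y].
  have c1 : theta1 z.1 @[z --> (x, y)] --> theta1 x.
    by apply: (cvg_comp _ _ cvg_fst); exact: cth1.
  have c2 : theta2 z.2 @[z --> (x, y)] --> theta2 y.
    by apply: (cvg_comp _ _ cvg_snd); exact: cth2.
  have : row_mx (theta1 z.1) (theta2 z.2) @[z --> (x, y)] -->
      row_mx (theta1 x) (theta2 y).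
    apply: cvg_rV => i; rewrite -[i]splitK; case: fintype.split => j /=.
      by rewrite row_mxEl; under eq_fun do rewrite row_mxEl; exact: cvg_entry.
    by rewrite row_mxEr; under eq_fun do rewrite row_mxEr; exact: cvg_entry.
  exact.
- move=> v /sub3[v1 v2].
  have cl : {for v, continuous (@lsubmx R 1 n1 n2)}.
    apply: (@cvg_rV _ _ _ (nbhs v) _) => i.
    by rewrite mxE; under eq_fun do rewrite mxE; exact: coord_continuous.
  have cr : {for v, continuous (@rsubmx R 1 n1 n2)}.
    apply: (@cvg_rV _ _ _ (nbhs v) _) => i.
    by rewrite mxE; under eq_fun do rewrite mxE; exact: coord_continuous.
  apply: (@cvg_pair _ _ _ (nbhs v) _ _ _ _ _ (zeta1 \o lsubmx) (zeta2 \o rsubmx)).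
    exact: (continuous_comp cl (cze1 _ v1)).
  exact: (continuous_comp cr (cze2 _ v2)).
Qed.

(** M * M is a manifold of dimension 2n on which the exchange of coordinates
is free off the diagonal: disjoint charts at x and y give a chart at (x, y)
which is disjoint from its image. *)
Lemma off_diagonal_map n (M : topologicalType) (K : set (M * M)) :
  topological_manifold R n M -> compact K -> (forall p, K p -> p.1 <> p.2) ->
  exists g : 'I_(n + n).+1 -> M * M -> R,
  [/\ forall i, continuous (g i), forall i x y, g i (y, x) = - g i (x, y) &
      forall p, K p -> exists i, g i p != 0].
Proof.
move=> [hM _ leM] cK K_off.
have [| | |g [cg og gK]] := @odd_nonvanishing R _ (n + n)
    (fun p : M * M => (p.2, p.1)) K (hausdorff_prod hM hM) _ _ cK.
- by move=> p; apply: cvg_pair; [exact: cvg_snd|exact: cvg_fst].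
- by case.
- move=> [x y] /K_off/= /eqP xy.
  have := hM; rewrite open_hausdorff => /(_ _ _ xy).
  move=> [[A B] /= [/set_mem Ax /set_mem By] [oA oB /eqP AB0]].
  have [O1 [t1 [z1 [ch1 Ox t1x O1A]]]] := manifold_chart leM oA Ax.
  have [O2 [t2 [z2 [ch2 Oy t2y O2B]]]] := manifold_chart leM oB By.
  exists (O1 `*` O2), (fun p => row_mx (t1 p.1) (t2 p.2)),
    (fun v => (z1 (lsubmx v), z2 (rsubmx v))); split.
  + exact: prod_chart.
  + by [].
  + by rewrite /= t1x t2y row_mx0 normr0.
  + move=> [a b] [/= /O1A Aa _] [/= _ /O2B Ba].
    by have : (A `&` B) a by []; rewrite AB0.
- by exists g; split => // i x y; rewrite -og.
Qed.
End manifold_charts.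

(** * Odd maps from spheres to a contractible space *)

Section clamp.
Context (R : realType).
Local Notation I := (unit_interval R).

Definition ival (s : I) : R := @set_val R `[0 : R, 1]%classic s.

Lemma ival_inj : injective ival.
Proof.
move=> [a a1] [b b1] /= ab.
exact: (@val_inj _ _ (set_type `[0 : R, 1]%classic)).
Qed.

Lemma ival_itv (s : I) : 0 <= ival s <= 1.
Proof. by have := @set_valP R `[0 : R, 1]%classic s; rewrite /= in_itv. Qed.

Lemma clamp_mem (t : R) : Num.max 0 (Num.min 1 t) \in `[0 : R, 1]%classic.
Proof.
by rewrite mem_setE in_itv/= le_max lexx/= ge_max ler01 ge_min lexx.
Qed.

(** Retraction of the line onto the unit interval. It allows the parameter
of a homotopy to be given by a real formula. *)
Definition clamp (t : R) : I := exist _ (Num.max 0 (Num.min 1 t)) (clamp_mem t).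

Lemma ival_clamp t : ival (clamp t) = Num.max 0 (Num.min 1 t).
Proof. by []. Qed.

Lemma ival0 : ival zero = 0. Proof. by []. Qed.

Lemma ival1 : ival one = 1. Proof. by []. Qed.

Lemma clampK (s : I) : clamp (ival s) = s.
Proof.
apply/ival_inj; rewrite ival_clamp; have /andP[s0 s1] := ival_itv s.
by rewrite min_r// max_r.
Qed.

Lemma clamp_le0 t : t <= 0 -> clamp t = zero.
Proof.
move=> t0; apply/ival_inj; rewrite ival_clamp ival0 min_r ?max_l//.
by apply: (le_trans t0).
Qed.

Lemma clamp_ge1 t : 1 <= t -> clamp t = one.
Proof. by move=> t1; apply/ival_inj; rewrite ival_clamp ival1 min_l// max_r. Qed.

Lemma clamp_continuous : continuous clamp.
Proof.
apply: (@continuous_comp_initial (set_type `[0 : R, 1]%classic) R R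
  (@set_val R `[0 : R, 1]%classic) clamp).
move=> t; apply: cvg_maxr; first exact: cvg_cst.
by apply: cvg_minr; [exact: cvg_cst|exact: cvg_id].
Qed.

Lemma ival_continuous : continuous ival.
Proof. exact: (@initial_continuous (set_type `[0 : R, 1]%classic)). Qed.

End clamp.

Lemma continuous_if (X Y : topologicalType) (f g : X -> Y) (b : X -> bool) x :
  {for x, continuous f} -> {for x, continuous g} -> f x = g x ->
  {for x, continuous (fun y => if b y then f y else g y)}.
Proof.
move=> cf cg fg W /=; rewrite -fg if_same => Wx.
have fW : nbhs x (f @^-1` W) := cf W Wx.
rewrite fg in Wx; have gW : nbhs x (g @^-1` W) := cg W Wx.
apply: filterS (filterI fW gW) => y [fy gy] /=.
by case: ifP.
Qed.

Lemma near_continuous (X Y : topologicalType) (f g : X -> Y) x :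
  (\forall y \near x, f y = g y) -> {for x, continuous f} ->
  {for x, continuous g}.
Proof.
move=> fg cf; rewrite /prop_for /continuous_at -(nbhs_singleton fg).
exact: cvg_trans (near_eq_cvg fg) cf.
Qed.

Lemma continuous_pair (X Y Z : topologicalType) (f : X -> Y) (g : X -> Z) x :
  {for x, continuous f} -> {for x, continuous g} ->
  {for x, continuous (fun y => (f y, g y))}.
Proof. by move=> cf cg; exact: (@cvg_pair _ _ _ (nbhs x) _ _ _ _ _ f g cf cg). Qed.

Lemma continuous_fst (X Y : topologicalType) : continuous (@fst X Y).
Proof. by move=> p; exact: cvg_fst. Qed.

Lemma continuous_snd (X Y : topologicalType) : continuous (@snd X Y).
Proof. by move=> p; exact: cvg_snd. Qed.

Section odd_sphere_maps.
Context (R : realType) (Y : topologicalType) (tau : Y -> Y).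
Local Notation I := (unit_interval R).
Hypotheses (ctau : continuous tau) (tauK : involutive tau).
Hypothesis contr : null_homotopic R (@idfun Y).

(** Induction on the dimension. For a vector with last part x and new
coordinate t >= 0, the value is H (Phi x, t / |x|), where H is the
contraction; it is constant as soon as t >= |x|, so that the singularity at
x = 0 disappears. For t < 0, the value is dictated by oddness, and both
formulas give Phi x at t = 0. Starting from the space of dimension 0, where
there is no nonzero vector, makes the base case empty. *)
Lemma odd_sphere_map j : exists Phi : 'rV[R]_j -> Y,
  (forall v : 'rV[R]_j, v != 0 -> {for v, continuous Phi}) /\
  (forall v, v != 0 -> Phi (- v) = tau (Phi v)).
Proof.
case: contr => c [H [cH H0 H1]].
elim: j => [|j [Phi [cPhi oPhi]]].
  by exists (cst c); split => v /eqP[]; apply/rowP => -[].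
pose x (v : 'rV[R]_(1 + j)) : 'rV[R]_j := rsubmx v.
pose t (v : 'rV[R]_(1 + j)) : R := v ord0 (lshift j ord0).
have xN v : x (- v) = - x v by apply/rowP => i; rewrite !mxE.
have tN v : t (- v) = - t v by rewrite /t mxE.
have ct : continuous t by exact: coord_continuous.
have cx : continuous x.
  move=> v; apply: (@cvg_rV _ _ _ (nbhs v) _) => i.
  by rewrite mxE; under eq_fun do rewrite mxE; exact: coord_continuous.
have cxn : continuous (fun v => `|x v|).
  by move=> v; apply: continuous_comp; [exact: cx|exact: norm_continuous].
pose F v := if `|x v| <= t v then c
  else H (Phi (x v), clamp (t v / `|x v|)).
have F0 v : t v = 0 -> x v != 0 -> F v = Phi (x v).
  move=> t0 x0; rewrite /F t0 leNgt normr_gt0 x0 /= mul0r clamp_le0//; exact: H0.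
have cF v : x v != 0 \/ 0 < t v -> {for v, continuous F}.
  have [x0|x0] := eqVneq (x v) 0; last first.
  - move=> _.
    apply: (@near_continuous _ _ (fun v => H (Phi (x v), clamp (t v / `|x v|)))).
      have : \forall w \near v, `|x w| > 0.
        have cxv : `|x w| @[w --> v] --> `|x v| := cxn v.
        by apply: (cvgr_gt _ cxv); rewrite normr_gt0.
      apply: filterS => w xw; rewrite /F; case: ifP => // xt.
      by rewrite clamp_ge1 ?H1// ler_pdivlMr// mul1r.
    have c1 : {for v, continuous (fun w => Phi (x w))}.
      exact: (continuous_comp (cx v) (cPhi _ x0)).
    have c2 : {for v, continuous (fun w => clamp (t w / `|x w|))}.
      have c3 : {for v, continuous (fun w => t w / `|x w|)}.
        apply: (@cvgM _ _ (nbhs v) _); first exact: ct.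
        by apply: cvgV; [rewrite normr_eq0|exact: cxn].
      exact: (continuous_comp c3 (@clamp_continuous R _)).
    apply: continuous_comp; last exact: cH.
    exact: continuous_pair c1 c2.
  - case=> [|t0]; first by rewrite ?x0 ?eqxx.
    apply: (@near_continuous _ _ (cst c)); last exact: cst_continuous.
    have ctx : (fun w => t w - `|x w|) @ v --> t v - `|x v|.
      by apply: (@cvgB _ _ _ (nbhs v) _); [exact: ct|exact: cxn].
    have : \forall w \near v, 0 < t w - `|x w|.
      by apply: (cvgr_gt _ ctx); rewrite x0 normr0 subr0.
    by apply: filterS => w; rewrite subr_gt0 /F => /ltW ->.
have xt0 v : v != 0 -> t v = 0 -> x v != 0.
  move=> v0 t0; apply: contra v0 => /eqP x0; rewrite -[v]hsubmxK -/(x v) x0.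
  apply/eqP; rewrite (_ : lsubmx v = 0) ?row_mx0//.
  by apply/rowP => i; rewrite !mxE ord1.
exists (fun v : 'rV_(1 + j) => if 0 <= t v then F v else tau (F (- v))); split.
- move=> v v0.
  have cN : {for v, continuous (fun w : 'rV_(1 + j) => - w)} by exact: opp_continuous.
  have cG : x v != 0 \/ t v < 0 ->
      {for v, continuous (fun w : 'rV_(1 + j) => tau (F (- w)))}.
    move=> h; apply: continuous_comp; last exact: ctau.
    apply: (continuous_comp cN); apply: cF; rewrite xN tN oppr_eq0 oppr_gt0.
    exact: h.
  have ctv : t w @[w --> v] --> t v := ct v.
  case: (ltgtP (t v) 0) => tv.
  + apply: near_continuous (cG (or_intror tv)).
    have : \forall w \near v, t w < 0 by exact: (cvgr_lt _ ctv _ tv).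
    by apply: filterS => w tw; rewrite leNgt tw.
  + apply: near_continuous (cF _ (or_intror tv)).
    have : \forall w \near v, 0 < t w by exact: (cvgr_gt _ ctv _ tv).
    by apply: filterS => w /ltW ->.
  + have xv := xt0 _ v0 tv; apply: continuous_if.
    * by apply: cF; left.
    * by apply: cG; left.
    * by rewrite !F0 ?tN ?tv ?oppr0// ?xN ?oppr_eq0// oPhi// tauK.
- move=> v v0; rewrite tN opprK oppr_ge0; case: (ltgtP (t v) 0) => tv.
  + by rewrite tauK.
  + by [].
  + have xv := xt0 _ v0 tv.
    by rewrite !F0 ?tN ?tv ?oppr0// ?xN ?oppr_eq0// oPhi.
Qed.

(** The compact set is the image of the d-sphere under an odd map, on which
the functions have a common zero by the Borsuk-Ulam theorem. *)
Lemma contractible_common_zero d : exists2 C : set Y, compact C &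
  forall G : 'I_d -> Y -> R, (forall i, continuous (G i)) ->
    (forall i y, G i (tau y) = - G i y) ->
    exists2 y, C y & forall i, G i y = 0.
Proof.
have [Phi [cPhi oPhi]] := odd_sphere_map d.+1.
have sphere0 (v : 'rV[R]_d.+1) : `|v| = 1 -> v != 0.
  by move=> v1; rewrite -normr_eq0 v1 oner_eq0.
exists (Phi @` [set v | `|v| = 1]).
  apply: continuous_compact; last exact: compact_sphere.
  by apply: continuous_in_subspaceT => v; rewrite inE /= => /sphere0/cPhi.
move=> G cG oG.
have [|v i v0|v v1 Gv] := @borsuk_ulam R d (fun i v => G i (Phi v)).
- move=> v i v0; apply: (continuous_comp (cPhi _ v0)); exact: cG.
- by rewrite oPhi.
- by exists (Phi v) => //; exists v.
Qed.
End odd_sphere_maps.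

(** * Maps and homotopies on suspensions *)

Local Open Scope quotient_scope.

Section interval_topology.
Context (R : realType).
Local Notation I := (unit_interval R).

Lemma compact_unit_interval : compact [set: I].
Proof.
rewrite (_ : [set: I] = @clamp R @` `[0, 1]).
  apply: continuous_compact; last exact: segment_compact.
  by apply: continuous_subspaceT; exact: clamp_continuous.
apply/seteqP; split => // s _; exists (ival s); last exact: clampK.
by rewrite /= in_itv /= ival_itv.
Qed.

Lemma hausdorff_unit_interval : hausdorff_space I.
Proof.
move=> p q pq; apply: ival_inj; apply: (@norm_hausdorff R R^o) => A B pA qB.
have [s [As Bs]] : ((@ival R) @^-1` A) `&` ((@ival R) @^-1` B) !=set0.
  by apply: pq; exact: ival_continuous.
by exists (ival s).
Qed.

Lemma locally_compact_unit_interval : locally_compact [set: I].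
Proof.
move=> s _; rewrite withinET; exists setT; first exact: filterT.
by split; [exact: compact_unit_interval|exact: closedT].
Qed.

End interval_topology.

Section quotient_homotopy.
Import ArrowAsCompactOpen.

(** The product of a quotient map with the identity of the unit interval is
again a quotient map, because the interval is locally compact: by currying,
homotopies are maps into the space of paths with the compact-open topology.
*)
Lemma quotient_prod_continuous (R : realType) (T Z : topologicalType)
    (Q0 : quotType T) (f : quotient_topology Q0 * unit_interval R -> Z) :
  continuous (fun p : T * unit_interval R =>
    f (\pi_(quotient_topology Q0) p.1, p.2)) ->
  continuous f.
Proof.
move=> cf; have [cc cc'] := continuous_curry cf.
rewrite (_ : f = uncurry (curry f)); last by apply/funext => -[].
apply: continuous_uncurry.
- exact: locally_compact_unit_interval.
- exact: hausdorff_unit_interval.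
- by apply/quotient_continuous; exact: cc.
- by move=> u; rewrite -[u]reprK; exact: cc'.
Qed.

End quotient_homotopy.

Section suspension_maps.
Context (R : realType) (X : topologicalType).
Local Notation I := (unit_interval R).
Local Notation SX := (suspension R X).

Definition susp_pt (x : X) (t : I) : SX := \pi_SX (x, t).

Lemma susp_pt_eq x y s t : susp_pt x s = susp_pt y t ->
  [\/ x = y /\ s = t, s = zero /\ t = zero | s = one /\ t = one].
Proof.
move=> /eqmodP.
move=> /or3P[/eqP[-> ->]|/andP[/eqP/= -> /eqP/= ->]|/andP[/eqP/= -> /eqP/= ->]].
- exact: Or31.
- exact: Or32.
- exact: Or33.
Qed.

Lemma susp_pt_zero x y : susp_pt x zero = susp_pt y zero.
Proof. by apply/eqmodP; rewrite /= /susp_rel /= !eqxx orbT. Qed.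

Lemma susp_pt_one x y : susp_pt x one = susp_pt y one.
Proof. by apply/eqmodP; rewrite /= /susp_rel /= !eqxx !orbT. Qed.

Lemma suspW (P : SX -> Prop) : (forall x t, P (susp_pt x t)) -> forall y, P y.
Proof. by move=> Ppt y; rewrite -[y]reprK; case: (repr y) => x t; exact: Ppt. Qed.

Lemma susp_pt_continuous : continuous (fun a : X * I => susp_pt a.1 a.2).
Proof.
rewrite (_ : (fun _ => _) = \pi_SX); first exact: pi_continuous.
by apply/funext => -[].
Qed.

(** Functions on the suspension are defined on representatives; susp_liftE
gives their value when they are constant on both ends of the cylinder. *)
Definition susp_lift (Z : Type) (f : X -> I -> Z) (y : SX) : Z :=
  f (repr y).1 (repr y).2.

Lemma susp_liftE (Z : Type) (f : X -> I -> Z) x t :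
  (forall x y, f x zero = f y zero) -> (forall x y, f x one = f y one) ->
  susp_lift f (susp_pt x t) = f x t.
Proof.
move=> f0 f1; rewrite /susp_lift.
have : susp_pt (repr (susp_pt x t)).1 (repr (susp_pt x t)).2 = susp_pt x t.
  by rewrite /susp_pt -surjective_pairing reprK.
by move=> /susp_pt_eq[[-> ->]//|[-> ->]|[-> ->]].
Qed.

Lemma susp_lift_continuous (Z : topologicalType) (f : X -> I -> Z) :
  (forall x y, f x zero = f y zero) -> (forall x y, f x one = f y one) ->
  continuous (fun a : X * I => f a.1 a.2) -> continuous (susp_lift f).
Proof.
move=> f0 f1 cf; apply/quotient_continuous.
rewrite (_ : _ \o _ = fun a : X * I => f a.1 a.2)//.
by apply/funext => -[x t]; exact: susp_liftE.
Qed.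

Definition height : SX -> R := susp_lift (fun _ t => ival t).

Lemma heightE x t : height (susp_pt x t) = ival t.
Proof. by rewrite /height susp_liftE. Qed.

Lemma height_continuous : continuous height.
Proof.
apply: susp_lift_continuous => // a.
by apply: (cvg_comp _ _ cvg_snd); exact: ival_continuous.
Qed.

(** The projection of the suspension minus its poles; its values at the
poles are arbitrary. *)
Definition base (y : SX) : X := (repr y).1.

Lemma baseE x t : 0 < ival t < 1 -> base (susp_pt x t) = x.
Proof.
move=> t01; have : susp_pt (repr (susp_pt x t)).1 (repr (susp_pt x t)).2 = susp_pt x t.
  by rewrite /susp_pt -surjective_pairing reprK.
move=> /susp_pt_eq[[]//|[_ t0]|[_ t1]]; move: t01.
  by rewrite t0 ival0 ltxx.
by rewrite t1 ival1 ltxx andbF.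
Qed.

Lemma base_continuous y : 0 < height y < 1 -> {for y, continuous base}.
Proof.
move=> y01 W /=; rewrite nbhsE => -[O [oO Oy] OW].
pose A := [set z | 0 < height z < 1 /\ O (base z)].
have oA : open A.
  rewrite /open /= /quotient_open.
  rewrite (_ : _ @^-1` A = [set a | (0 < ival a.2 < 1) /\ O a.1]).
    rewrite openE => -[x t] [/= /andP[t0 t1] Ox].
    have ct : ival a.2 @[a --> (x, t)] --> ival t.
      by apply: (cvg_comp _ _ cvg_snd); exact: ival_continuous.
    have h1 : \forall a \near (x, t), 0 < ival a.2 by exact: (cvgr_gt _ ct _ t0).
    have h2 : \forall a \near (x, t), ival a.2 < 1 by exact: (cvgr_lt _ ct _ t1).
    have h3 : \forall a \near (x, t), O a.1.
      by apply: cvg_fst; exact: open_nbhs_nbhs.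
    by near=> a; split; [apply/andP; split|]; near: a.
  apply/seteqP; split => -[x t] /=; rewrite -/(susp_pt x t) /A /= heightE.
    by move=> [t01]; rewrite baseE.
  by move=> [t01 Ox]; rewrite baseE.
have : nbhs y A by apply: open_nbhs_nbhs.
by apply: filterS => z [_ /OW].
Unshelve. all: by end_near. Qed.

End suspension_maps.

(** * The category of a suspension *)

Section flip.
Context (R : realType).
Local Notation I := (unit_interval R).

Definition flip (t : I) : I := clamp (1 - ival t).

Lemma ival_flip t : ival (flip t) = 1 - ival t.
Proof.
rewrite /flip ival_clamp; have /andP[t0 t1] := ival_itv t.
by rewrite min_r ?max_r//; lra.
Qed.

Lemma flipK : involutive flip.
Proof. by move=> t; apply: ival_inj; rewrite !ival_flip; ring. Qed.

Lemma flip0 : flip zero = one.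
Proof. by apply: ival_inj; rewrite ival_flip ival0 ival1 subr0. Qed.

Lemma flip1 : flip one = zero.
Proof. by rewrite -flip0 flipK. Qed.

Lemma flip_continuous : continuous flip.
Proof.
move=> t; apply: (@continuous_comp _ _ _ (fun t : I => 1 - ival t) (@clamp R)).
  apply: (@cvgB _ _ _ (nbhs t) _); first exact: cvg_cst.
  exact: ival_continuous.
exact: clamp_continuous.
Qed.

End flip.

Section suspension_flip.
Context (R : realType) (X : topologicalType) (sigma : X -> X).
Local Notation SX := (suspension R X).
Hypotheses (csigma : continuous sigma) (sigmaK : involutive sigma).

Definition susp_flip : SX -> SX :=
  susp_lift (fun x t => susp_pt (sigma x) (flip t)).

Lemma susp_flipE x t : susp_flip (susp_pt x t) = susp_pt (sigma x) (flip t).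
Proof.
apply: susp_liftE => a b; first by rewrite flip0; exact: susp_pt_one.
by rewrite flip1; exact: susp_pt_zero.
Qed.

Lemma susp_flip_continuous : continuous susp_flip.
Proof.
apply: susp_lift_continuous => [a b|a b|].
- by rewrite flip0; exact: susp_pt_one.
- by rewrite flip1; exact: susp_pt_zero.
move=> a.
apply: (@continuous_comp _ _ _ (fun a => (sigma a.1, flip a.2))
  (fun a : X * unit_interval R => susp_pt a.1 a.2)).
  apply: continuous_pair.
    by apply: continuous_comp; [exact: continuous_fst|exact: csigma].
  by apply: continuous_comp; [exact: continuous_snd|exact: flip_continuous].
exact: susp_pt_continuous.
Qed.

Lemma susp_flipK : involutive susp_flip.
Proof. by apply: suspW => x t; rewrite !susp_flipE sigmaK flipK. Qed.

End suspension_flip.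

Section suspension_category.
Context (R : realType) (X : topologicalType).
Local Notation SX := (suspension R X).
Local Notation I := (unit_interval R).

(** A self-homotopy of the interval that fixes both endpoints induces a
homotopy of the suspension. If it moves the heights occurring in U to an
endpoint e, then it contracts U to a pole. *)
Lemma contractible_in_slide (x0 : X) (lam : I * I -> I) (e : I) (U : set SX) :
  continuous lam -> (forall s, lam (zero, s) = zero) ->
  (forall s, lam (one, s) = one) -> e = zero \/ e = one ->
  (forall x t, U (susp_pt x t) -> lam (t, zero) = t /\ lam (t, one) = e) ->
  contractible_in R U.
Proof.
move=> clam lam0 lam1 e01 lamU.
pose H (p : SX * I) : SX := susp_lift (fun x t => susp_pt x (lam (t, p.2))) p.1.
have HE x t s : H (susp_pt x t, s) = susp_pt x (lam (t, s)).
  apply: susp_liftE => a b /=; first by rewrite lam0; exact: susp_pt_zero.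
  by rewrite lam1; exact: susp_pt_one.
have cH : continuous H.
  apply: quotient_prod_continuous.
  rewrite (_ : (fun _ => _) = fun p : X * I * I => susp_pt p.1.1 (lam (p.1.2, p.2))).
    move=> p.
    apply: (@continuous_comp _ _ _ (fun p => (p.1.1, lam (p.1.2, p.2)))
      (fun a : X * unit_interval R => susp_pt a.1 a.2)).
      apply: continuous_pair.
        by apply: continuous_comp; exact: continuous_fst.
      apply: continuous_comp; last exact: clam.
      apply: continuous_pair; last exact: continuous_snd.
      by apply: continuous_comp; [exact: continuous_fst|exact: continuous_snd].
    exact: susp_pt_continuous.
  by apply/funext => -[[x t] s]; exact: HE.
have H0 y : U y -> H (y, zero) = y.
  by move: y; apply: suspW => x t /lamU[lt _]; rewrite HE lt.
have H1 y : U y -> H (y, one) = susp_pt x0 e.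
  move: y; apply: suspW => x t /lamU[_ lt]; rewrite HE lt.
  by case: e01 => ->; [exact: susp_pt_zero|exact: susp_pt_one].
exists (susp_pt x0 e), (fun p => H (set_val p.1, p.2)); split.
- move=> p; apply: continuous_comp; last exact: cH.
  apply: continuous_pair; last exact: continuous_snd.
  by apply: continuous_comp; [exact: continuous_fst|exact: initial_continuous].
- by move=> u; exact: H0 (set_valP u).
- by move=> u; exact: H1 (set_valP u).
Qed.

(** The open sets are the points of height less than 3/4 and more than 1/4.
The homotopy max ((1 - s) t, 4 t - 3) shrinks [0, 3/4] linearly to 0 and
keeps 1 fixed; reflecting it deals with the second set. *)
Lemma suspension_cover (x0 : X) : LS_cover R SX 2.
Proof.
pose lam (p : I * I) : I :=
  clamp (Num.max ((1 - ival p.2) * ival p.1) (4 * ival p.1 - 3)).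
have clam : continuous lam.
  move=> p; have c1 : {for p, continuous (fun q : I * I => ival q.1)}.
    by apply: continuous_comp; [exact: continuous_fst|exact: ival_continuous].
  have c2 : {for p, continuous (fun q : I * I => ival q.2)}.
    by apply: continuous_comp; [exact: continuous_snd|exact: ival_continuous].
  apply: continuous_comp; last exact: clamp_continuous.
  apply: (@cvg_maxr _ _ (nbhs p) _).
    apply: (@cvgM _ _ (nbhs p) _); last exact: c1.
    by apply: (@cvgB _ _ _ (nbhs p) _); [exact: cvg_cst|exact: c2].
  apply: (@cvgB _ _ _ (nbhs p) _); last exact: cvg_cst.
  by apply: (@cvgMl_tmp _ _ (nbhs p) _); exact: c1.
have lam0 s : lam (zero, s) = zero.
  by apply: clamp_le0; rewrite ival0 /= mulr0 ge_max lexx/=; lra.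
have lam1 s : lam (one, s) = one.
  by apply: clamp_ge1; rewrite ival1 /= le_max; apply/orP; right; lra.
have lamt t : ival t < 3 / 4 -> lam (t, zero) = t /\ lam (t, one) = zero.
  move=> t3; have /andP[t0 t1] := ival_itv t; split.
    rewrite -[RHS]clampK /lam /=; congr clamp.
    by rewrite ival0 subr0 mul1r max_l//; lra.
  by apply: clamp_le0; rewrite ival1 /= subrr mul0r ge_max lexx /=; lra.
exists (fun i : 'I_2 => if i == ord0 then [set y | height y < 3 / 4]
   else [set y | 1 / 4 < height y]); split.
- move=> i; case: ifP => _.
    rewrite (_ : [set _ | _] = (@height R X) @^-1` [set r | r < 3 / 4])//.
    by apply: open_comp; [move=> y _; exact: height_continuous|exact: (@open_lt R)].
  rewrite (_ : [set _ | _] = (@height R X) @^-1` [set r | 1 / 4 < r])//.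
  by apply: open_comp; [move=> y _; exact: height_continuous|exact: (@open_gt R)].
- apply/seteqP; split => // y _; have [y3|y3] := ltP (height y) (3 / 4).
    by exists ord0.
  by exists (@Ordinal 2 1 isT) => //=; lra.
- move=> i; case: ifP => _.
    apply: (@contractible_in_slide x0 lam zero) => //; first by left.
    by move=> x t /=; rewrite heightE; exact: lamt.
  apply: (@contractible_in_slide x0 (fun p => flip (lam (flip p.1, p.2))) one).
  + move=> p; apply: continuous_comp; last exact: flip_continuous.
    apply: continuous_comp; last exact: clam.
    apply: continuous_pair; last exact: continuous_snd.
    by apply: continuous_comp; [exact: continuous_fst|exact: flip_continuous].
  + by move=> s /=; rewrite flip0 lam1 flip1.
  + by move=> s /=; rewrite flip1 lam0 flip0.
  + by right.
  + move=> x t /=; rewrite heightE => t4.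
    have [] := lamt (flip t); first by rewrite ival_flip; lra.
    by move=> -> ->; rewrite flipK flip0.
Qed.

(** If a single open set covers the space, then its inclusion is the
identity. *)
Lemma LS_cover1_contractible (Y : topologicalType) :
  LS_cover R Y 1 -> null_homotopic R (@idfun Y).
Proof.
move=> [U [_ Ucov /(_ ord0)[c [H [cH H0 H1]]]]].
have UT y : U ord0 y by have : setT y by []; rewrite -Ucov => -[i _]; rewrite ord1.
pose j (y : Y) : set_type (U ord0) := SigSub (mem_set (UT y)).
have cj : continuous j.
  apply: (@continuous_comp_initial (set_type (U ord0)) Y Y set_val j).
  by move=> y; exact: cvg_id.
exists c, (fun p => H (j p.1, p.2)); split.
- move=> p; apply: continuous_comp; last exact: cH.
  apply: continuous_pair; last exact: continuous_snd.
  by apply: continuous_comp; [exact: continuous_fst|exact: cj].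
- by move=> y; rewrite H0.
- by move=> y; rewrite H1.
Qed.

Lemma LS_cat_suspension (x0 : X) : ~ null_homotopic R (@idfun SX) ->
  LS_cat R SX = Some 2%N.
Proof.
move=> ncontr; rewrite /LS_cat; case: pselect => [ex|[]]; last first.
  by exists 2%N; apply/asboolP; exact: suspension_cover.
congr Some; case: ex_minnP => m /asboolP cm minm.
have m2 : (m <= 2)%N by apply: minm; apply/asboolP; exact: suspension_cover.
case: m m2 cm {minm} => [|[|[|]]]// _.
  move=> [U [_ Ucov _]]; have : setT (susp_pt x0 (zero : I)) by [].
  by rewrite -Ucov => -[[]].
by move=> /LS_cover1_contractible.
Qed.

End suspension_category.

(** * Configuration spaces *)

Lemma continuous_ptws (X T : topologicalType) (I : Type)
    (f : X -> {ptws I -> T}) :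
  (forall i, continuous (fun x => f x i)) -> continuous f.
Proof.
move=> cf x; apply/cvg_sup => i A [B [[O oO <-] /= Ox] BA].
have nO : nbhs x ((fun y => f y i) @^-1` O).
  by apply: cf; exact: open_nbhs_nbhs.
by apply: filterS nO => y Oy; exact: BA.
Qed.

Section configuration_spaces.
Context (R : realType) (M : topologicalType) (k : nat).
Local Notation F := (configuration_space M k).

Definition conf_point (m : F) (i : 'I_k) : M := (set_val m : 'I_k -> M) i.

Lemma conf_point_continuous i : continuous (conf_point ^~ i).
Proof.
move=> m; apply: (@continuous_comp F {ptws 'I_k -> M} M set_val (fun f => f i)).
  exact: initial_continuous.
exact: (@proj_continuous _ (fun=> M) i).
Qed.

Lemma conf_point_inj (m : F) i j : i != j -> conf_point m i <> conf_point m j.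
Proof. by move=> ij; exact: (set_valP m _ _ ij). Qed.

Lemma permute_conf_subproof (s : 'S_k) (m : F) :
  (fun i => conf_point m (s i)) \in @configuration M k.
Proof.
by rewrite inE => i j ij /=; apply: conf_point_inj; rewrite (inj_eq perm_inj).
Qed.

Definition permute_conf (s : 'S_k) (m : F) : F :=
  exist _ (fun i => conf_point m (s i)) (permute_conf_subproof s m).

Lemma permute_confE s m i :
  conf_point (permute_conf s m) i = conf_point m (s i).
Proof. by []. Qed.

Lemma permute_conf_continuous s : continuous (permute_conf s).
Proof.
apply: continuous_comp_initial; apply: continuous_ptws => i.
exact: conf_point_continuous.
Qed.

Lemma permute_confK (s : 'S_k) : involutive s -> involutive (permute_conf s).
Proof.
move=> sK m; apply: val_inj; apply/funext => i.
by rewrite -[LHS]/(conf_point m (s (s i))) sK.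
Qed.

(** A chart of positive dimension contains as many distinct points as
desired. *)
Lemma conf_nonempty n (p : M) : (0 < n)%N -> locally_euclidean R n M ->
  [set: F] !=set0.
Proof.
move=> n0 leM.
have [O [theta [zeta [[_ _ ze _ _] _ _ _]]]] :=
  manifold_chart leM (@openT M) (I : setT p).
pose v (i : 'I_k) : 'rV[R]_n := const_mx (i%:R / k%:R).
have v3 i : `|v i| < 3.
  apply: (@le_lt_trans _ _ 1); last by rewrite ltr1n.
  apply/mx_norm_leP => // a b; rewrite mxE ger0_norm ?divr_ge0//.
  have k0 : (0 < k)%N by exact: leq_ltn_trans (ltn_ord i).
  by rewrite ler_pdivrMr ?ltr0n// mul1r ler_nat ltnW.
have mP : (fun i => zeta (v i)) \in @configuration M k.
  rewrite inE => i j ij /(congr1 theta).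
  have [_ ->] := ze _ (v3 i); have [_ ->] := ze _ (v3 j) => vij.
  have k0 : k%:R != 0 :> R.
    by rewrite pnatr_eq0 -lt0n; exact: leq_ltn_trans (ltn_ord i).
  have := congr1 (fun w : 'rV[R]_n => w ord0 (Ordinal n0)) vij; rewrite !mxE.
  move/(mulIf (invr_neq0 k0))/eqP; rewrite eqr_nat => ij'.
  by case/negP: ij; exact: ij'.
by exists (exist _ (fun i => zeta (v i)) mP).
Qed.

End configuration_spaces.

Section not_contractible.
Context (R : realType).

(** The compact set C of contractible_common_zero meets the equator in a
compact set, whose first two points form a compact K off the diagonal. The
functions of off_diagonal_map for K, damped by t (1 - t) to be constant at
the poles, and the function t - 1/2 would have a common zero on C: it would
have height 1/2, hence lie over K. *)
Lemma suspension_configuration_not_contractible (M : topologicalType) n k :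
  topological_manifold R n M -> (2 <= k)%N ->
  ~ null_homotopic R (@idfun (suspension R (configuration_space M k))).
Proof.
move=> manM k2 contr.
set F := configuration_space M k in contr.
pose i0 : 'I_k := Ordinal (ltnW k2); pose i1 : 'I_k := Ordinal k2.
pose s : 'S_k := tperm i0 i1.
have sK : involutive s by move=> i; exact: tpermK.
have csw : continuous (@permute_conf M k s) by exact: permute_conf_continuous.
have swK : involutive (@permute_conf M k s) by exact: permute_confK.
have [C cC Czero] := contractible_common_zero
  (susp_flip_continuous (R := R) csw) (susp_flipK (R := R) swK) contr (n + n).+2.
pose e (m : F) : M * M := (conf_point m i0, conf_point m i1).
have ce : continuous e.
  by move=> m; apply: continuous_pair; exact: conf_point_continuous.
pose half := [set y : suspension R F | height y = 1 / 2].
have chalf : closed half.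
  rewrite (_ : half = (@height R F) @^-1` [set x | x = 1 / 2])//.
  by apply: preimage_closed; [move=> y _; exact: height_continuous|exact: (@closed_eq R)].
pose K := (e \o @base R F) @` (C `&` half).
have cK : compact K.
  apply: continuous_compact; last exact: compact_closedI.
  apply: continuous_in_subspaceT => y /set_mem[_ /= hy].
  apply: continuous_comp; last exact: ce.
  by apply: base_continuous; rewrite hy; lra.
have [|g [cg og gK]] := off_diagonal_map manM cK.
  by move=> _ [y _ <-]; exact: conf_point_inj.
pose G (i : 'I_(n + n).+2) (m : F) (t : unit_interval R) : R :=
  if unlift ord0 i is Some j then ival t * (1 - ival t) * g j (e m)
  else ival t - 1 / 2.
have G0 i m m' : G i m zero = G i m' zero.
  by rewrite /G; case: unlift => // j; rewrite ival0 !mul0r.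
have G1 i m m' : G i m one = G i m' one.
  by rewrite /G; case: unlift => // j; rewrite ival1 subrr mulr0 !mul0r.
have GE i m t : susp_lift (G i) (susp_pt m t) = G i m t by exact: susp_liftE.
have [|i y|y Cy Gy] := Czero (fun i => susp_lift (G i)).
- move=> i; apply: susp_lift_continuous; [exact: G0|exact: G1|].
  move=> a; have c2 : {for a, continuous (fun a : F * unit_interval R => ival a.2)}.
    by apply: continuous_comp; [exact: continuous_snd|exact: ival_continuous].
  rewrite /G; case: unlift => [j|]; last first.
    by apply: (@cvgB _ _ _ (nbhs a) _); [exact: c2|exact: cvg_cst].
  apply: (@cvgM _ _ (nbhs a) _).
    apply: (@cvgM _ _ (nbhs a) _); first exact: c2.
    by apply: (@cvgB _ _ _ (nbhs a) _); [exact: cvg_cst|exact: c2].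
  have c1 : {for a, continuous (fun a : F * unit_interval R => e a.1)}.
    by apply: continuous_comp; [exact: continuous_fst|exact: ce].
  exact: (continuous_comp c1 (cg j _)).
- move: y; apply: suspW => m t; rewrite susp_flipE !GE /G ival_flip.
  have -> : e (permute_conf s m) = ((e m).2, (e m).1).
    by rewrite /e !permute_confE tpermL tpermR.
  by case: unlift => [j|]; [rewrite og -surjective_pairing; ring|lra].
- move: y Cy Gy; apply: suspW => m t Cy Gy.
  have t2 : ival t = 1 / 2.
    by have := Gy ord0; rewrite GE /G unlift_none => /subr0_eq.
  have Km : K (e m).
    exists (susp_pt m t) => /=; last by rewrite baseE// t2; lra.
    by split => //; rewrite /half /= heightE.
  have [j /eqP[]] := gK _ Km.
  have := Gy (lift ord0 j); rewrite GE /G liftK t2 => /eqP.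
  by rewrite mulf_eq0 => /orP[/eqP h|/eqP//]; exfalso; lra.
Qed.

End not_contractible.

Theorem theorem4p11 (R : realType) (M : topologicalType) (n : nat) (k : nat)
    (dim_ge3 : (3 <= n)%N)
    (M_manifold : topological_manifold R n M)
    (M_simply_connected : simply_connected R M)
    (k_ge2 : (2 <= k)%N) :
  LS_cat R (suspension R (configuration_space M k)) = Some 2%N.
Proof.
have [p _] : [set: M] !=set0 by case: M_simply_connected => -[].
have [_ _ leM] := M_manifold.
have n0 : (0 < n)%N by exact: leq_trans dim_ge3.
have [m _] := conf_nonempty k p n0 leM.
apply: (LS_cat_suspension m).
exact: suspension_configuration_not_contractible M_manifold k_ge2.
Qed.
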